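(* Let $(P_{(\vartheta)})_{\vartheta\in[0,\infty)}$ be a family of continuous probability distributions on $[0,\infty)$ with $P_{(\vartheta)}\ll P_{(0)}$ and $$\frac{dP_{(\vartheta)}}{dP_{(0)}}=C(\vartheta)\exp(\vartheta T)$$ for functions $T:[0,\infty)\to\mathbb{R}$ and $C:[0,\infty)\to(0,\infty)$ with $C(0)=1$. Suppose that $T$ is strictly decreasing on $[0,\eta]$ for some $\eta>0$, that $T(\eta)\ge T(x)$ for all $x\ge\eta$, and that for some $p>0$ $$T(F_0^{-1}(0))-T(F_0^{-1}(u))=u^{1/p}L\Bigl(\frac1u\Bigr)\quad\text{as }u\searrow0$$ for a function $L$ slowly varying at infinity, where $F_0^{-1}$ is the left continuous quantile function of $P_{(0)}$. Let $P_0=P_{(0)}$ be the noise distribution and $\mu_n=P_{(\vartheta_n)}$ the signal distribution with $\vartheta_n=n^r$, $r>0$. Let $h_n$ be as in the context, let $\mathrm{Leb}$ denote Lebesgue measure, and set $$\beta^*=\beta^{\#}(r,p)=\frac{\min\{rp,1\}+1}{2}.$$ Then the following conditions are fulfilled, and $\beta^{\#}(r,p)$ is the detection threshold $\beta^{\#}$. (1) For every $\delta>0$, $$\liminf_{n\to\infty}\mathrm{Leb}\Bigl(t\ge\tfrac{\log 2}{\log n}:\ \beta^*-\delta-\tfrac12\le\frac{h_n(t)}{\log n}-t+\frac{\min\{t,1\}}{2}\Bigr)>0.$$ (2) For every $\delta>0$ and all sufficiently large $n$, $$\mathrm{Leb}\Bigl(t\ge\tfrac{\log 2}{\log n}:\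 \beta^*+\delta-\tfrac12\le\frac{h_n(t)}{\log n}-t+\frac{\min\{t,1\}}{2}\Bigr)=0.$$ (3) There are $M\ge1$ and a sequence $(\lambda_n)$ in $(0,\infty)$ with $\lambda_n\to0$ and $\lambda_nn^\kappa\to\infty$ for all $\kappa>0$ such that either $\lim_{n\to\infty}\sup_{t\ge M}\bigl|\frac{h_n(t)}{\log n}-\gamma(t)\bigr|=0$ for some $\gamma:(0,\infty)\to\mathbb{R}$, or for every $\delta>0$ and all sufficiently large $n$ $$\mathrm{Leb}\Bigl(t\ge M:\ \beta^*+\delta-1\le\frac{h_n(t)}{\log n}-\Bigl(1-\frac{\lambda_n}{\log n}\Bigr)t\Bigr)=0.$$
   Context: $F_0$ is the distribution function of $P_0=P_{(0)}$ and $F_0^{-1}(u)=\inf\{x\ge0:F_0(x)\ge u\}$. A function $L$ is slowly varying at infinity if $\lim_{x\to\infty}L(\lambda x)/L(x)=1$ for all $\lambda>0$. For $t>0$ let $$h_{n,1}(t)=\log\Bigl(\frac{d\mu_n}{dP_0}\bigl(F_0^{-1}(n^{-t})\bigr)\Bigr),\quad h_{n,2}(t)=\log\Bigl(\frac{d\mu_n}{dP_0}\bigl(F_0^{-1}(1-n^{-t})\bigr)\Bigr),\quad h_n(t)=\max\{h_{n,1}(t),h_{n,2}(t)\}.$$ Testing problem: $\varepsilon_n=n^{-\beta}$ with $\beta\in(1/2,1]$, $Q_n=(1-\varepsilon_n)P_0+\varepsilon_n\mu_n$; $\mathcal H_{0,n}$: $X_{n,1},\ldots,X_{n,n}$ i.i.d.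 $\sim P_0$; $\mathcal H_{1,n}$: $X_{n,1},\ldots,X_{n,n}$ i.i.d. $\sim Q_n$. A sequence of tests $\varphi_n$ (measurable functions of the sample with values in $[0,1]$) completely separates $\mathcal H_{0,n}$ and $\mathcal H_{1,n}$ asymptotically if $E_{P_0^n}(\varphi_n)+E_{Q_n^n}(1-\varphi_n)\to0$, and cannot distinguish between them asymptotically if this sum tends to $1$. The detection threshold $\beta^{\#}$ is the value such that for $\beta>\beta^{\#}$ no sequence of tests can distinguish $\mathcal H_{0,n}$ and $\mathcal H_{1,n}$ asymptotically, and for $\beta<\beta^{\#}$ some sequence of likelihood ratio tests (tests rejecting for large values of $dQ_n^n/dP_0^n$) completely separates them asymptotically. *)

(* Defs.v *)
From HB Require Import structures.
From mathcomp Require Import all_boot all_order all_algebra.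
From mathcomp Require Import interval_inference.
From mathcomp Require Import all_classical all_reals all_analysis.

Set Implicit Arguments.
Unset Strict Implicit.
Unset Printing Implicit Defensive.

Import Order.TTheory GRing.Theory Num.Theory.
Import numFieldNormedType.Exports.

Local Open Scope classical_set_scope.
Local Open Scope ring_scope.
Local Open Scope charge_scope.

(* Distributions on [0, +oo[ are probability measures on the Borel sets of R
   giving mass 1 to [0, +oo[. *)

Definition distr_fun (R : realType) (P : probability (measurableTypeR R) R)
  (x : R) : R := fine (P `]-oo, x]%classic).

(* The set is nonempty and bounded below for 0 <= u < 1, the only levels at
   which quantiles are used. *)
Definition quantile (R : realType) (P : probability (measurableTypeR R) R)
  (u : R) : R := inf [set x | 0 <= x /\ u <= distr_fun P x].

Definition slowly_varying (R : realType) (L : R -> R) : Prop :=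
  forall lambda : R, 0 < lambda -> L (lambda * x) / L x @[x --> +oo] --> (1 : R).

(* f is an everywhere defined version, on D, of the density of nu with respect
   to mu; 'd nu '/d mu alone is determined only up to mu-null sets. *)
Definition is_density (R : realType) d (X : measurableType d)
    (nu mu : probability X R) (D : set X) (f : X -> R) : Prop :=
  [/\ nu `<< mu, measurable_fun D f &
      ae_eq mu D ('d (charge_of_finite_measure nu) '/d mu) (EFin \o f)].

Section iid.
Context (R : realType) d (X : measurableType d).

Definition cons_pair n (x : X * n.-tuple X) : n.+1.-tuple X :=
  [tuple of x.1 :: x.2].

Lemma measurable_cons_pair n : measurable_fun setT (@cons_pair n).
Proof. exact: measurable_cons. Qed.

HB.instance Definition _ n :=
  @isMeasurableFun.Build _ _ _ _ (@cons_pair n) (@measurable_cons_pair n).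

(* n-fold product of P on the product sigma-algebra of n.-tuple X *)
Fixpoint iid (P : probability X R) (n : nat) : probability (n.-tuple X) R :=
  match n with
  | 0 => \d_([tuple] : 0.-tuple X)
  | m.+1 => distribution (P \x iid P m)%E (@cons_pair m)
  end.

End iid.

Section mixture.
Context (R : realType) d (X : measurableType d).
Variables (e : {i01 R}) (P mu : probability X R).

Definition mixture : set X -> \bar R :=
  measure_add (mscale (1 - e%:num)%:nng P) (mscale (e%:num)%:nng mu).

HB.instance Definition _ := Measure.on mixture.

Lemma mixture_setT : mixture setT = 1%E.
Proof.
rewrite /mixture measure_addE/= /mscale/= [P _]probability_setT.
by rewrite [mu _]probability_setT !mule1 -EFinD subrK.
Qed.

HB.instance Definition _ :=
  @Measure_isProbability.Build _ _ R mixture mixture_setT.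

End mixture.

Lemma powR_nat_le1 (R : realType) (beta : {i01 R}) (n : nat) :
  n%:R `^ (- beta%:num) <= 1.
Proof.
case: n => [|n]; first by rewrite /powR eqxx; case: (_ == _).
by rewrite powRN invf_le1 ?powR_gt0// -[leLHS](powRr0 n.+1%:R) ler_powR// ler1n.
Qed.

Definition sparsity (R : realType) (beta : {i01 R}) (n : nat) : {i01 R} :=
  Itv01 (powR_ge0 n%:R (- beta%:num)) (powR_nat_le1 beta n).

Section testing.
Context (R : realType) (n : nat).
Local Notation X := (measurableTypeR R).
Implicit Types (P Q : probability X R) (phi : n.-tuple X -> R).

Definition is_test phi : Prop :=
  measurable_fun setT phi /\ forall x, 0 <= phi x <= 1.

Definition error_sum P Q phi : \bar R :=
  ('E_(iid P n)[phi] + 'E_(iid Q n)[fun x => (1 - phi x)%R])%E.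

Definition is_lr_test P Q phi : Prop :=
  is_test phi /\
  exists (lr : n.-tuple X -> R) (c gamma : R),
    is_density (iid Q n) (iid P n) setT lr /\
    forall x, phi x = if c < lr x then 1 else if lr x == c then gamma else 0.

End testing.

Section model.
Context (R : realType).
Local Notation X := (measurableTypeR R).
Variables (P0 : probability X R).

(* b separates the undetectable sparsity exponents from the completely
   detectable ones inside the parameter range 1/2 < beta <= 1. *)
Definition detection_threshold (mu : nat -> probability X R) (b : R) : Prop :=
  forall beta : {i01 R}, 2^-1 < beta%:num ->
  let Q n : probability X R := mixture (sparsity beta n) P0 (mu n) in
  (b < beta%:num ->
    forall phi : forall n, n.-tuple X -> R, (forall n, is_test (phi n)) ->
      error_sum P0 (Q n) (phi n) @[n --> \oo] --> 1%E) /\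
  (beta%:num < b ->
    exists phi : forall n, n.-tuple X -> R,
      (forall n, is_lr_test P0 (Q n) (phi n)) /\
      error_sum P0 (Q n) (phi n) @[n --> \oo] --> 0%E).

(* f n stands for (a version of) the density of mu_n with respect to P0. *)
Variable f : nat -> R -> R.

Definition h1 (n : nat) (t : R) : R :=
  ln (f n (quantile P0 (n%:R `^ (- t)))).

Definition h2 (n : nat) (t : R) : R :=
  ln (f n (quantile P0 (1 - n%:R `^ (- t)))).

Definition h (n : nat) (t : R) : R := Num.max (h1 n t) (h2 n t).

End model.

(* Main.v *)
Require Import Defs.
From mathcomp Require Import all_boot all_order all_algebra.
From mathcomp Require Import interval_inference.
From mathcomp Require Import all_classical all_reals all_analysis.
From mathcomp Require Import measurable_realfun.
From mathcomp Require Import ring lra.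

Set Implicit Arguments.
Unset Strict Implicit.
Unset Printing Implicit Defensive.

Import Order.TTheory GRing.Theory Num.Theory.
Import numFieldNormedType.Exports.

Local Open Scope classical_set_scope.
Local Open Scope ring_scope.

(** Write q for the quantile function of P_0, gap u = T 0 - T (q u), and
    peak v = C v * exp (v * T 0), the supremum of dP_v/dP_0.  Then
    dP_v/dP_0 (q u) = peak v * exp (- v * gap u), and the whole theorem is read
    off from the growth of these two functions.

    The hypothesis says that gap is regularly varying at 0 with index 1/p.  As
    T decreases near 0, gap is monotone there, so that comparing gap (u / 2)
    with gap u along a sequence of halvings already gives the Potter bounds
    gap u = u^(1/p + o(1)) (regularly_varying_bounds).  Cutting the total mass
    1 = P_v R at q u with u = v^(-p -+ small) turns them into
    peak v = v^(p + o(1)) (ln_peak_le, ln_peak_ge).  For v = n^r this makes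
    h_n(t) / ln n close to r p, uniformly in t >= r p + kappa, and negative
    for t <= r p - kappa, where v * gap (n^-t) is a positive power of n; it is
    never much larger than r p (near_h_le, near_h_le0, near_h_ge).
    The function h_n(t) / ln n - t + min(t, 1) / 2 is therefore asymptotically
    maximal at t = r p, with value beta* - 1/2, which is what the two Lebesgue
    measure conditions express.  The third condition holds in its uniform
    convergence form, with gamma constant equal to r p.

    For the detection threshold, let e_n = n^-beta, let g = 1 - e_n + e_n f be
    the density of Q_n with respect to P_0, f that of mu_n, and let lr be the
    product of the g (x_i), the likelihood ratio of the two product laws.

    Above beta* (so r p < 1) the chi-square distance vanishes: as f <= peak,
    one has int g^2 dP_0 <= 1 + e_n^2 peak (n^r), so that int lr^2 dP_0^n is at
    most exp (n^(1 - 2 beta + r p + o(1))), which tends to 1, and by the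
    inequality |ab| <= (s a^2 + b^2 / s) / 2 no test has an error sum far
    from 1 (error_sum_near1).

    Below beta*, the likelihood ratio test that rejects when lr > 1 has error
    sum int min(1, lr) <= int sqrt lr = (int sqrt g dP_0)^n (lr_test_error),
    and this Hellinger affinity is at most the one that remains when each x_i
    is reduced to the indicator of A = [0, q u] (integral_sqrt_density, up to
    a constant in the exponent).  For u = n^-t with
    2 beta - 1 < t < min(r p, 1) nearly all of the signal lies in A, so that
    Q_n A - P_0 A is of order e_n, and
    n (Q_n A - P_0 A)^2 / (Q_n A + P_0 A) is at least a positive power of n. *)

(** * Regular variation at 0 *)

Section regular_variation.
Context {R : realType}.
Implicit Types (w L : R -> R) (u alpha : R).

Lemma at0P (P : R -> Prop) :
  (\forall u \near 0^'+, P u) <->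
  exists2 u0 : R, 0 < u0 & forall u, 0 < u <= u0 -> P u.
Proof.
split=> [P0|[u0 u00 uP]]; last first.
  by near=> u; apply: uP; apply/andP; split; near: u;
    [exact: nbhs_right_gt|exact: nbhs_right_le].
have [e /= e0 eP] := P0.
exists (e / 2); first by rewrite divr_gt0.
move=> u /andP[u0 ue]; apply: eP => //=.
by rewrite sub0r normrN gtr0_norm//; lra.
Unshelve. all: by end_near. Qed.

(** Every point of ]0, u0] is brought into ]u0 / 2, u0] by finitely many
    doublings. *)
Lemma halving_bound (v : R -> R) (u0 K : R) : 0 < u0 ->
  (forall u, 0 < u <= u0 -> v (u / 2) <= v u) ->
  (forall u, u0 / 2 < u <= u0 -> v u <= K) ->
  forall u, 0 < u <= u0 -> v u <= K.
Proof.
move=> u00 vhalf vK.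
have vKk k u : u0 / 2 ^+ k < u <= u0 -> v u <= K.
  elim: k u => [|k IH] u /andP[ku uu0].
    by move: ku; rewrite expr0 divr1 ltNge uu0.
  have u_gt0 : 0 < u by apply: lt_trans ku; rewrite divr_gt0// exprn_gt0.
  have [uh|uh] := ltP (u0 / 2) u; first by apply: vK; rewrite uh.
  have -> : u = (2 * u) / 2 by rewrite mulrC mulKf.
  apply: (le_trans (vhalf (2 * u) _)); first by apply/andP; split; lra.
  apply: IH; apply/andP; split; last by lra.
  move: ku; rewrite exprS invfM mulrA mulrAC ltr_pdivrMr//; lra.
move=> u /andP[u_gt0 uu0].
pose k := Num.bound (u0 / u).
apply: (vKk k); rewrite uu0 andbT.
rewrite ltr_pdivrMr ?exprn_gt0// mulrC -ltr_pdivrMr//.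
apply: (@lt_trans _ _ k%:R).
  by apply: archi_boundP; rewrite divr_ge0 ?ltW.
by rewrite -natrX ltr_nat ltn_expl.
Qed.

(** Local boundedness takes the place of monotonicity, so that the statement
    also applies to 1 / w, which gives the lower Potter bound. *)
Lemma regularly_varying_le w alpha kappa :
  (\forall u \near 0^'+, 0 < w u) ->
  (\forall u0 \near 0^'+, exists K, forall u, u0 / 2 < u <= u0 -> w u <= K) ->
  w (u / 2) / w u @[u --> 0^'+] --> 2 `^ (- alpha) ->
  0 < kappa ->
  \forall u \near 0^'+, w u <= u `^ (alpha - kappa).
Proof.
move=> w0 wloc wlim k0.
pose e := - (alpha - kappa / 2).
have whalf : \forall u \near 0^'+, w (u / 2) <= 2 `^ e * w u.
  have : 2 `^ (- alpha) < 2 `^ e :> R.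
    rewrite /powR (_ : (2 == 0 :> R) = false) ?pnatr_eq0// ltr_expR ltr_pM2r.
      by rewrite /e; lra.
    by rewrite ln_gt0// ltr1n.
  move=> /(cvgr_lt _ wlim) H; near=> u.
  rewrite -ler_pdivrMr; last by near: u.
  by apply/ltW; near: u.
have /at0P[u0 u00 u0P] : \forall u \near 0^'+, [/\ 0 < w u,
    w (u / 2) <= 2 `^ e * w u &
    exists K, forall u', u / 2 < u' <= u -> w u' <= K].
  by near=> u; split; near: u.
have [_ _ [K wK]] := u0P u0 ltac:(by rewrite u00 lexx).
(* the factor u `^ e compensates the decay of w, up to kappa / 2 *)
pose v u := w u * u `^ e.
have [K' K'0 vK'] : exists2 K', 0 < K' & forall u, 0 < u <= u0 -> v u <= K'.
  exists (`|K| * (u0 `^ e + (u0 / 2) `^ e) + 1).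
    by rewrite ltr_wpDl// mulr_ge0// addr_ge0// powR_ge0.
  apply: halving_bound => // [u /andP[u_gt0 uu0]|u /andP[hu uu0]].
    have [wu_gt0 wu _] := u0P u ltac:(by rewrite u_gt0).
    rewrite /v -ler_pdivlMr ?powR_gt0 ?divr_gt0// (le_trans wu)//.
    rewrite ler_pdivlMr ?powR_gt0 ?divr_gt0// mulrAC -powRM//; last first.
      by rewrite divr_ge0// ltW.
    have -> : 2 * (u / 2) = u by field.
    by rewrite mulrC.
  have u_gt0 : 0 < u by apply: lt_trans hu; rewrite divr_gt0.
  rewrite /v -[leLHS]addr0 lerD//; apply: ler_pM.
  - by have [/ltW] := u0P u ltac:(by rewrite u_gt0).
  - exact: powR_ge0.
  - by rewrite (le_trans (wK _ _)) ?ler_norm// hu.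
  - have [ege0|ele0] := leP 0 e.
      apply: ler_wpDr; first exact: powR_ge0.
      by apply: ge0_ler_powR => //; rewrite ?nnegrE ltW.
    apply: ler_wpDl; first exact: powR_ge0.
    rewrite -[e]opprK powRN [leRHS]powRN lef_pV2 ?posrE ?powR_gt0 ?divr_gt0//.
    by apply: ge0_ler_powR; rewrite ?nnegrE ?oppr_ge0 ?divr_ge0// ltW.
(* the other half of kappa absorbs the constant K' *)
have small : \forall u \near 0^'+, u `^ (kappa / 2) < K'^-1.
  have := @powR_cvg0 R (kappa / 2) ltac:(by rewrite divr_gt0).
  by move=> /cvgr_lt; apply; rewrite invr_gt0.
near=> u.
have u_gt0 : 0 < u by near: u; exact: nbhs_right_gt.
have : v u <= K'.
  by apply: vK'; rewrite u_gt0/=; near: u; exact: nbhs_right_le.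
rewrite /v -ler_pdivlMr ?powR_gt0// => /le_trans; apply.
have -> : alpha - kappa = - e - kappa / 2 by rewrite /e; lra.
rewrite powRD; last by rewrite (gt_eqF u_gt0)/= implybT.
rewrite powRN mulrC ler_pM2l ?invr_gt0 ?powR_gt0// powRN.
rewrite -[leLHS]invrK lef_pV2 ?posrE ?invr_gt0 ?powR_gt0//.
by apply/ltW; near: u.
Unshelve. all: by end_near. Qed.

(** Potter's bounds, for functions monotone near 0. *)
Lemma regularly_varying_bounds w alpha kappa :
  (\forall u \near 0^'+, 0 < w u) ->
  (\forall v \near 0^'+, forall u, 0 < u <= v -> w u <= w v) ->
  w (u / 2) / w u @[u --> 0^'+] --> 2 `^ (- alpha) ->
  0 < kappa ->
  \forall u \near 0^'+, u `^ (alpha + kappa) <= w u <= u `^ (alpha - kappa).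
Proof.
move=> w0 /at0P[u1 u10 wmono] wlim k0.
have wloc : \forall u0 \near 0^'+, forall u, u0 / 2 < u <= u0 ->
    w (u0 / 2) <= w u <= w u0.
  near=> u0 => u /andP[hu uu0].
  have u00 : 0 < u0 by near: u0; exact: nbhs_right_gt.
  have u0u1 : u0 <= u1 by near: u0; exact: nbhs_right_le.
  have u_gt0 : 0 < u by apply: lt_trans hu; rewrite divr_gt0.
  apply/andP; split; apply: wmono; apply/andP; split; lra.
have upper : \forall u \near 0^'+, w u <= u `^ (alpha - kappa).
  apply: regularly_varying_le => //.
  near=> u0; exists (w u0) => u uu0.
  by have /(_ u uu0)/andP[] : forall u, u0 / 2 < u <= u0 ->
    w (u0 / 2) <= w u <= w u0 by near: u0.
have lower : \forall u \near 0^'+, (w u)^-1 <= u `^ (- alpha - kappa).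
  apply: (@regularly_varying_le (fun u => (w u)^-1)) => //.
  - by near=> u; rewrite invr_gt0; near: u.
  - have : \forall u \near 0^'+, 0 < w (u / 2).
      move/at0P : w0 => [u0 u00 wu0]; apply/at0P; exists u0 => // u /andP[? ?].
      by apply: wu0; lra.
    move=> wh; near=> u0; exists (w (u0 / 2))^-1 => u uu0.
    have /(_ u uu0)/andP[wu _] : forall u, u0 / 2 < u <= u0 ->
      w (u0 / 2) <= w u <= w u0 by near: u0.
    have wh0 : 0 < w (u0 / 2) by near: u0.
    by rewrite lef_pV2// posrE (lt_le_trans wh0).
  - rewrite powRN; apply: cvg_trans (cvgV _ wlim); last first.
      by rewrite gt_eqF// powR_gt0.
    by apply: near_eq_cvg; near=> u; rewrite /= invfM invrK mulrC.
near=> u.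
have u_gt0 : 0 < u by near: u; exact: nbhs_right_gt.
have wu0 : 0 < w u by near: u.
apply/andP; split; last by near: u.
rewrite -lef_pV2 ?posrE ?powR_gt0// -powRN opprD.
by near: u.
Unshelve. all: by end_near. Qed.

(** Along the halvings of a point w decreases geometrically, which excludes a
    positive lower bound. *)
Lemma regularly_varying_small w alpha c : 0 < alpha ->
  (\forall u \near 0^'+, 0 < w u) ->
  w (u / 2) / w u @[u --> 0^'+] --> 2 `^ (- alpha) ->
  0 < c -> ~ \forall u \near 0^'+, c <= w u.
Proof.
move=> alpha0 w0 wlim c0 wc.
pose lam : R := (2 `^ (- alpha) + 1) / 2.
have lim1 : 2 `^ (- alpha) < 1 :> R.
  by rewrite /powR pnatr_eq0/= expR_lt1 mulNr oppr_lt0 mulr_gt0// ln_gt0// ltr1n.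
have lam0 : 0 < lam by rewrite divr_gt0// addr_gt0// powR_gt0.
have lam1 : lam < 1 by rewrite /lam; lra.
have whalf : \forall u \near 0^'+, w (u / 2) <= lam * w u.
  have /(cvgr_lt _ wlim) H : 2 `^ (- alpha) < lam by rewrite /lam; lra.
  near=> u; rewrite -ler_pdivrMr; last by near: u.
  by apply/ltW; near: u.
have /at0P[u0 u00 u0P] : \forall u \near 0^'+,
    w (u / 2) <= lam * w u /\ c <= w u.
  by near=> u; split; near: u.
have wk k : w (u0 / 2 ^+ k) <= lam ^+ k * w u0.
  elim: k => [|k IH]; first by rewrite !expr0 divr1 mul1r.
  have k0 : 0 < u0 / 2 ^+ k by rewrite divr_gt0// exprn_gt0.
  have [|h _] := u0P (u0 / 2 ^+ k).
    rewrite k0 ler_pdivrMr ?exprn_gt0// ler_peMr ?(ltW u00)//.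
    by rewrite exprn_ege1// ler1n.
  rewrite [2 ^+ k.+1]exprSr invfM mulrA (le_trans h)//.
  by rewrite exprS -mulrA ler_wpM2l// ltW.
have /cvgr_lt/(_ c c0) : (lam ^+ k * w u0) @[k --> \oo] --> (0 : R).
  rewrite -[X in _ --> X](mul0r (w u0)); apply: cvgMl.
  by apply: cvg_expr; rewrite ger0_norm// ltW.
move=> [k _ /(_ k (leqnn k))] /=; apply/negP; rewrite -leNgt.
apply: le_trans (wk k); apply: (u0P _ _).2.
rewrite divr_gt0 ?exprn_gt0//= ler_pdivrMr ?exprn_gt0// ler_peMr ?(ltW u00)//.
by rewrite exprn_ege1// ler1n.
Unshelve. all: by end_near. Qed.

(** The scaling factor 2 is the only one for which slow variation is used.
    As x / 0 = 0, the limit 1 of the quotients also forces L, hence w, not to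
    vanish near the limit point. *)
Lemma slowly_varying_halving w L alpha : slowly_varying L ->
  (\forall u \near 0^'+, w u = u `^ alpha * L u^-1) ->
  w (u / 2) / w u @[u --> 0^'+] --> 2 `^ (- alpha) /\
  \forall u \near 0^'+, w u != 0.
Proof.
move=> /(_ 2 ltac:(lra)) Llim wE.
have invy : u^-1 @[u --> 0^'+] --> (+oo : set_system R).
  apply/(@cvgrVy _ _ _ _ id); first exact: nbhs_right_gt.
  exact: cvg_at_right_filter.
have Llim0 : L (2 * u^-1) / L u^-1 @[u --> 0^'+] --> (1 : R).
  exact: (cvg_comp _ _ invy Llim).
have L0 : \forall u \near 0^'+, L u^-1 != 0.
  near=> u; have : L (2 * u^-1) / L u^-1 != 0.
    by near: u; apply: (cvgr_neq0 _ Llim0); exact: oner_neq0.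
  by apply: contraNneq => ->; rewrite invr0 mulr0.
have wEh : \forall u \near 0^'+, w (u / 2) = (u / 2) `^ alpha * L (2 * u^-1).
  move/at0P : wE => [u0 u00 wu0]; apply/at0P; exists u0 => // u /andP[u_gt0 ?].
  rewrite wu0; first by rewrite invfM invrK (mulrC u^-1).
  by apply/andP; split; lra.
split.
  apply: cvg_trans (_ : (2 `^ (- alpha) * (L (2 * u^-1) / L u^-1))
      @[u --> 0^'+] --> 2 `^ (- alpha)); last first.
    by rewrite -[X in _ --> X]mulr1; apply: cvgMr.
  apply: near_eq_cvg; near=> u.
  have u_gt0 : 0 < u by near: u; exact: nbhs_right_gt.
  have Lu : L u^-1 != 0 by near: u.
  rewrite (near wEh u)// (near wE u)//.
  have -> : u `^ alpha = 2 `^ alpha * (u / 2) `^ alpha.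
    rewrite -powRM//; last by rewrite divr_ge0// ltW.
    by congr (_ `^ _); field.
  have uh0 : (u / 2) `^ alpha != 0 by rewrite gt_eqF// powR_gt0// divr_gt0.
  by rewrite powRN; field; rewrite Lu uh0 gt_eqF// powR_gt0.
near=> u; rewrite (near wE u)// mulf_neq0//; last by near: u.
by rewrite gt_eqF// powR_gt0//; near: u; exact: nbhs_right_gt.
Unshelve. all: by end_near. Qed.

End regular_variation.
(** * Limits at infinity *)

Section asymptotics.
Context {R : realType}.
Implicit Types (Q : R -> Prop) (a c K : R).

Lemma near_pinfty_mul Q a : 0 < a ->
  (\forall s \near +oo, Q s) -> \forall l \near +oo, Q (a * l).
Proof.
move=> a0 Qy; have cvgal : a * l @[l --> +oo] --> (+oo : set_system R).
  by apply: gt0_cvgMry => //; exact: cvg_id.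
exact: cvgal Qy.
Qed.

Lemma near_ln_nat Q : (\forall l \near +oo, Q l) ->
  \forall n \near \oo, Q (ln (n%:R : R)).
Proof.
move=> Qy; have cvgln : ln (n%:R : R) @[n --> \oo] --> (+oo : set_system R).
  apply/cvgryPge => A; near=> n.
  have An : expR A <= n%:R by near: n; exact: nbhs_infty_ger.
  by rewrite -(expRK A) ler_ln// posrE ?expR_gt0// (lt_le_trans _ An) ?expR_gt0.
exact: cvgln Qy.
Unshelve. all: by end_near. Qed.

Lemma near_linear_le_expR c K : 0 < c -> \forall l \near +oo, K * l <= expR (c * l).
Proof.
move=> c0; near=> l.
have l0 : 0 < l by near: l; apply: nbhs_pinfty_gt; exact: num_real.
have lK : 2 * K / c ^+ 2 <= l by near: l; apply: nbhs_pinfty_ge; exact: num_real.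
have cl0 : 0 <= c * l by rewrite mulr_ge0 ?ltW.
have := @expR_ge1Dxn R (c * l) 1 cl0.
apply: le_trans; rewrite ler_wpDl// (_ : 2`! = 2)%N//.
rewrite ler_pdivlMr//; move: lK; rewrite ler_pdivrMr ?exprn_gt0// => lK.
by have := ler_wpM2r (ltW l0) lK; lra.
Unshelve. all: by end_near. Qed.

End asymptotics.
Lemma limn_einf_ge (R : realType) (a : \bar R) (u : (\bar R)^nat) :
  (\forall n \near \oo, (a <= u n)%E) -> (a <= limn_einf u)%E.
Proof.
move=> [N _ Nu]; rewrite limn_einf_lim; apply: lime_ge.
  exact: is_cvg_einfs.
exists N => // n /= Nn; apply: le_ereal_inf_tmp => _ [m /= nm <-].
by apply: Nu => /=; exact: leq_trans nm.
Qed.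

(** The Lebesgue measure of an arbitrary set is its outer measure, which is
    monotone. *)
Lemma le_lebesgue_measure (R : realType) (A B : set R) : A `<=` B ->
  (lebesgue_measure A <= lebesgue_measure B)%E.
Proof.
move=> AB; rewrite /lebesgue_measure /lebesgue_stieltjes_measure.
by rewrite /measure_extension; exact: le_mu_ext.
Qed.

Lemma cvge_norm_le (R : realType) (u : (\bar R)^nat) (a : R) :
  (forall e : R, 0 < e -> \forall n \near \oo, (`|u n - a%:E| <= e%:E)%E) ->
  u n @[n --> \oo] --> a%:E.
Proof.
move=> ua; apply/fine_cvgP; split.
  have := ua 1 ltr01; apply: filterS => n.
  by case: (u n) => [x| |].
apply/cvgrPdist_le => e e0; have := ua e e0; apply: filterS => n /=.
by case: (u n) => [x| |]//=; rewrite lee_fin distrC.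
Qed.

Lemma inv_ln_rate (R : realType) : exists lambda : nat -> R,
  [/\ forall n, 0 < lambda n, lambda n @[n --> \oo] --> (0 : R) &
      forall kappa : R, 0 < kappa ->
        lambda n * n%:R `^ kappa @[n --> \oo] --> +oo].
Proof.
pose lam (n : nat) : R := if (1 < n)%N then (ln n%:R)^-1 else 1.
have lamE n : (1 < n)%N -> lam n = (ln n%:R)^-1 by rewrite /lam => ->.
have ln0 n : (1 < n)%N -> 0 < ln n%:R :> R by move=> n1; rewrite ln_gt0// ltr1n.
exists lam; split.
- move=> n; rewrite /lam; case: ifP => // n1.
  by rewrite invr_gt0 ln0.
- apply/cvgr0Pnorm_le => e e0.
  have H : \forall n \near \oo, e^-1 <= ln (n%:R : R).
    apply: (@near_ln_nat _ (fun l => e^-1 <= l)).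
    by apply: nbhs_pinfty_ge; exact: num_real.
  near=> n.
  have n1 : (1 < n)%N by near: n; exists 2%N.
  have el : e^-1 <= ln (n%:R : R) by near: n.
  rewrite lamE// ger0_norm; last by rewrite invr_ge0 ltW ?ln0.
  by rewrite -[leRHS]invrK lef_pV2// posrE ?invr_gt0 ?ln0.
- move=> k k0; apply/cvgryPge => A.
  have H := near_ln_nat (near_linear_le_expR A k0).
  near=> n.
  have n1 : (1 < n)%N by near: n; exists 2%N.
  have h : A * ln n%:R <= expR (k * ln n%:R) by near: n.
  rewrite lamE// mulrC ler_pdivlMr ?ln0//.
  by rewrite /powR pnatr_eq0 gtn_eqF// ltnW.
Unshelve. all: by end_near. Qed.

(** * Product laws and their densities *)

Lemma integral_prob_cst (R : realType) d (X : measurableType d)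
    (P : probability X R) (c : \bar R) : (\int[P]_x c = c)%E.
Proof.
rewrite (integral_cst P measurableT c) -[RHS]mule1; congr (_ * _)%E.
exact: probability_setT.
Qed.

Section product_laws.
Context (R : realType) d (X : measurableType d).
Implicit Types (P Q : probability X R).

Lemma integral_iidS P n (psi : n.+1.-tuple X -> \bar R) :
  measurable_fun setT psi -> (forall x, 0 <= psi x)%E ->
  (\int[iid P n.+1]_x psi x =
   \int[P]_x \int[iid P n]_y psi (cons_pair (x, y)))%E.
Proof.
move=> mpsi psi0.
rewrite (@ge0_integral_distribution _ _ _ _ _ (P \x iid P n)%E)//=.
rewrite fubini_tonelli1//.
by apply: measurableT_comp => //; exact: measurable_cons_pair.
Qed.

Definition prodf n (g : X -> R) (x : n.-tuple X) : R :=
  \prod_(i < n) g (tnth x i).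

Lemma prodf_cons n (g : X -> R) x (y : n.-tuple X) :
  prodf g (cons_pair (x, y)) = g x * prodf g y.
Proof.
rewrite /prodf big_ord_recl; congr (_ * _).
by apply: eq_bigr => i _; rewrite tnthS.
Qed.

Lemma prodf_ge0 n (g : X -> R) (x : n.-tuple X) :
  (forall y, 0 <= g y) -> 0 <= prodf g x.
Proof. by move=> g0; apply: prodr_ge0. Qed.

Lemma measurable_prodf n (g : X -> R) :
  measurable_fun setT g -> measurable_fun setT (@prodf n g).
Proof.
move=> mg; apply: measurable_prod => i _.
by apply: measurableT_comp => //; exact: measurable_tnth.
Qed.

Lemma integral_prodf P n (g : X -> R) :
  measurable_fun setT g -> (forall y, 0 <= g y) ->
  (\int[iid P n]_x (prodf g x)%:E = (\int[P]_x (g x)%:E) ^+ n)%E.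
Proof.
move=> mg g0; elim: n => [|n IH].
  rewrite expe0 /= integral_dirac//= ?diracT ?mul1e//.
    by rewrite /prodf big_ord0.
  by apply/measurable_EFinP; exact: measurable_prodf.
rewrite integral_iidS; last 2 first.
  by apply/measurable_EFinP; exact: measurable_prodf.
  by move=> x; rewrite lee_fin prodf_ge0.
under eq_integral => x _.
  under eq_integral do rewrite prodf_cons EFinM.
  rewrite ge0_integralZl_EFin//; last 2 first.
    by move=> y _; rewrite lee_fin prodf_ge0.
    by apply/measurable_EFinP; exact: measurable_prodf.
  rewrite IH muleC.
over.
rewrite ge0_integralZl//; last 3 first.
  by apply/measurable_EFinP.
  by move=> x _; rewrite lee_fin.
  by rewrite -IH integral_ge0// => x _; rewrite lee_fin prodf_ge0.
by rewrite expeS muleC.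
Qed.

(** Densities are stated through the integrals of all nonnegative functions,
    the form that passes to products by Fubini-Tonelli. *)
Definition has_density P Q (g : X -> R) : Prop :=
  [/\ measurable_fun setT g, forall x, 0 <= g x &
      forall psi : X -> \bar R, measurable_fun setT psi ->
        (forall x, 0 <= psi x)%E ->
        (\int[Q]_x psi x = \int[P]_x (psi x * (g x)%:E))%E].

Lemma integral_iid_density P Q n (g : X -> R) (psi : n.-tuple X -> \bar R) :
  has_density P Q g ->
  measurable_fun setT psi -> (forall x, 0 <= psi x)%E ->
  (\int[iid Q n]_x psi x = \int[iid P n]_x (psi x * (prodf g x)%:E))%E.
Proof.
move=> [mg g0 gQ]; elim: n psi => [|n IH] psi mpsi psi0.
  rewrite /= !integral_dirac//=; last first.
    by apply: emeasurable_funM => //; apply/measurable_EFinP; exact: measurable_prodf.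
  by rewrite diracT !mul1e /prodf big_ord0 mule1.
have mpsig : measurable_fun setT (fun x => psi x * (prodf g x)%:E)%E.
  by apply: emeasurable_funM => //; apply/measurable_EFinP; exact: measurable_prodf.
rewrite !integral_iidS//; last first.
  by move=> x; rewrite mule_ge0// lee_fin prodf_ge0.
have mpsi2 : measurable_fun setT (psi \o @cons_pair d X n).
  by apply: measurableT_comp => //; exact: measurable_cons_pair.
have mpsi1 x : measurable_fun setT (fun y => psi (cons_pair (x, y))).
  by move: (measurableT_comp mpsi2 (pair1_measurable x)).
rewrite gQ; last 2 first.
- by have := measurable_fun_fubini_tonelli_F (m2 := iid Q n) _ mpsi2; apply => /=.
- by move=> x; exact: integral_ge0.
apply: eq_integral => x _.
rewrite IH//.
rewrite -ge0_integralZr//; last 3 first.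
- apply: emeasurable_funM => //.
  by apply/measurable_EFinP; exact: measurable_prodf.
- by move=> y _; rewrite mule_ge0// lee_fin prodf_ge0.
- by rewrite lee_fin.
apply: eq_integral => y _; rewrite prodf_cons EFinM -muleA; congr (_ * _)%E.
by rewrite muleC.
Qed.

End product_laws.
(** * Error sums of tests *)

Section test_errors.
Context (R : realType) (n : nat).
Local Notation X := (measurableTypeR R).
Implicit Types (P Q : probability X R) (g : X -> R) (phi : n.-tuple X -> R).

Lemma prodf_is_density P Q g :
  has_density P Q g -> is_density (iid Q n) (iid P n) setT (prodf g).
Proof.
move=> gQ; have [mg g0 _] := gQ.
have mlr : measurable_fun [set: n.-tuple X] (prodf g) by exact: measurable_prodf.
have QE A : measurable A ->
    (iid Q n A = \int[iid P n]_(x in A) (prodf g x)%:E)%E.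
  move=> mA; rewrite -[A in LHS]setIT -integral_indic//.
  rewrite (integral_iid_density gQ)//; last first.
    by apply/measurable_EFinP; exact: measurable_indic.
  rewrite [RHS]integral_mkcond; apply: eq_integral => x _.
  by rewrite indicE patchE; case: (x \in A); rewrite ?mul1e ?mul0e.
have QP : iid Q n `<< iid P n.
  apply/null_content_dominatesP => A mA PA0.
  by rewrite QE// null_set_integral//; apply/measurable_EFinP/measurable_funTS.
split => //.
apply: integral_ae_eq => //.
- exact: Radon_Nikodym_integrable.
- exact/measurable_EFinP.
- by move=> E _ mE; rewrite -Radon_Nikodym_integral//; exact: QE.
Qed.

Lemma integral_prodf_density P Q g :
  has_density P Q g -> (\int[iid P n]_x (prodf g x)%:E = 1)%E.
Proof.
move=> gQ; rewrite -[RHS](integral_prob_cst (iid Q n)).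
rewrite (integral_iid_density gQ)//.
by apply: eq_integral => x _; rewrite mul1e.
Qed.

(** If g has second moment at most K then int (lr - 1)^2 dP^n <= K^n - 1, and
    phi (lr - 1) <= (s (lr - 1)^2 + 1 / s) / 2 since 0 <= phi <= 1.  The
    parameter s takes the place of the Cauchy-Schwarz inequality. *)
Lemma integral_test_le P Q g (K s : R) phi :
  has_density P Q g -> (\int[P]_x (g x ^+ 2)%:E <= K%:E)%E -> 0 < s ->
  is_test phi ->
  (\int[iid Q n]_x (phi x)%:E <=
   \int[iid P n]_x (phi x)%:E + (s / 2 * (K ^+ n - 1) + (2 * s)^-1)%:E)%E.
Proof.
move=> gQ gK s0 [mphi phi01]; have [mg g0 _] := gQ.
have mlr : measurable_fun [set: n.-tuple X] (prodf g) by exact: measurable_prodf.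
have lr0 x : 0 <= @prodf _ _ _ n g x by exact: prodf_ge0.
have phi0 x : 0 <= phi x by have /andP[] := phi01 x.
have phi1 x : phi x <= 1 by have /andP[] := phi01 x.
have int_lr := integral_prodf_density gQ.
have int_lr2 : (\int[iid P n]_x (prodf g x ^+ 2)%:E <= (K ^+ n)%:E)%E.
  rewrite (_ : (fun x => _) = (fun x => (prodf (fun y => g y ^+ 2) x)%:E)).
    rewrite integral_prodf//; last 2 first.
    - exact: measurable_funX.
    - by move=> y; exact: sqr_ge0.
    have : (0 <= \int[P]_x (g x ^+ 2)%:E)%E.
      by rewrite integral_ge0// => x _; rewrite lee_fin sqr_ge0.
    move: gK; case: (\int[P]_x _)%E => [r| |]//.
    rewrite !lee_fin -EFin_expe lee_fin => rK r0.
    by apply: lerXn2r; rewrite // nnegrE// (le_trans r0).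
  by apply/funext => x; rewrite /prodf prodrXl.
have mphiE : measurable_fun [set: n.-tuple X] (EFin \o phi) by exact/measurable_EFinP.
have mlrE : measurable_fun [set: n.-tuple X] (EFin \o prodf g).
  exact/measurable_EFinP.
have mlr2 : measurable_fun [set: n.-tuple X] (fun x => (prodf g x ^+ 2)%:E).
  by apply/measurable_EFinP; exact: measurable_funX.
pose c := s / 2 + (2 * s)^-1.
have c0 : 0 <= c by rewrite addr_ge0// ?invr_ge0 ?mulr_ge0 ?divr_ge0 ?ltW.
(* adding s = int s lr dP^n makes every integrand nonnegative *)
rewrite -(@leeD2rE _ s%:E)//.
have -> : (\int[iid Q n]_x (phi x)%:E + s%:E =
    \int[iid P n]_x ((phi x)%:E * (prodf g x)%:E + s%:E * (prodf g x)%:E))%E.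
  rewrite ge0_integralD//; last 4 first.
  - by move=> x _; rewrite mule_ge0 ?lee_fin.
  - exact: emeasurable_funM.
  - by move=> x _; rewrite mule_ge0 ?lee_fin// ltW.
  - exact: emeasurable_funM.
  rewrite -(integral_iid_density gQ)//.
  rewrite ge0_integralZl//; last 2 first.
  - by move=> x _; rewrite lee_fin.
  - by rewrite lee_fin ltW.
  by rewrite int_lr mule1.
apply: (@le_trans _ _ (\int[iid P n]_x
    ((phi x)%:E + ((s / 2)%:E * (prodf g x ^+ 2)%:E + c%:E)))%E).
  apply: ge0_le_integral => //.
  - by move=> x _; rewrite adde_ge0// mule_ge0 ?lee_fin// ltW.
  - by apply: emeasurable_funD; exact: emeasurable_funM.
  - apply: emeasurable_funD => //; apply: emeasurable_funD => //.
    exact: emeasurable_funM.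
  - move=> x _; rewrite -!EFinM -!EFinD lee_fin /c.
    have h : (phi x) * (prodf g x - 1) <=
        s / 2 * (prodf g x - 1) ^+ 2 + (2 * s)^-1.
      have -> : s / 2 * (prodf g x - 1) ^+ 2 + (2 * s)^-1 =
         (2 * s)^-1 * ((s * (prodf g x - 1)) ^+ 2 + 1).
        by field; rewrite gt_eqF.
      rewrite [leRHS]mulrC ler_pdivlMr ?mulr_gt0//.
      move: (phi0 x) (phi1 x) s0.
      set u := prodf g x; set f := phi x => f0 f1 s0'.
      have : 0 <= (s * (u - 1) - f) ^+ 2 by exact: sqr_ge0.
      have : f ^+ 2 <= 1 by rewrite expr_le1.
      by rewrite !expr2; lra.
    by move: h; rewrite !expr2; lra.
rewrite ge0_integralD//; last 3 first.
- by move=> x _; rewrite lee_fin.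
- move=> x _; rewrite adde_ge0// mule_ge0 ?lee_fin ?sqr_ge0//.
  by rewrite divr_ge0 ?ltW.
- by apply: emeasurable_funD => //; exact: emeasurable_funM.
rewrite -[leRHS]addeA; apply: leeD2l.
rewrite ge0_integralD//; last 2 first.
- move=> x _; rewrite mule_ge0 ?lee_fin ?sqr_ge0//.
  by rewrite divr_ge0 ?ltW.
- exact: emeasurable_funM.
rewrite integral_prob_cst.
rewrite ge0_integralZl//; last 2 first.
- by move=> x _; rewrite lee_fin sqr_ge0.
- by rewrite lee_fin divr_ge0 ?ltW.
apply: (@le_trans _ _ ((s / 2)%:E * (K ^+ n)%:E + c%:E)%E).
  by rewrite leeD2r// lee_pmul2l// lte_fin divr_gt0.
by rewrite -EFinM -!EFinD lee_fin /c; lra.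
Qed.

Lemma is_test_compl phi : is_test phi -> is_test (fun x => 1 - phi x).
Proof.
move=> [mphi phi01]; split; first exact: measurable_funB.
by move=> x; have := phi01 x; lra.
Qed.

Lemma integral_test_fin P phi : is_test phi ->
  exists a, (\int[iid P n]_x (phi x)%:E = a%:E)%E /\
            (\int[iid P n]_x (1 - phi x)%:E = (1 - a)%:E)%E.
Proof.
move=> tphi; have [mphi phi01] := tphi; have [mphi' phi01'] := is_test_compl tphi.
have sum1 : (\int[iid P n]_x (phi x)%:E + \int[iid P n]_x (1 - phi x)%:E = 1)%E.
  rewrite -ge0_integralD//; last 4 first.
  - by move=> x _; rewrite lee_fin; case/andP: (phi01 x).
  - exact/measurable_EFinP.
  - by move=> x _; rewrite lee_fin; case/andP: (phi01' x).
  - exact/measurable_EFinP.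
  under eq_integral do rewrite -EFinD subrKC.
  by rewrite integral_prob_cst.
have : (0 <= \int[iid P n]_x (1 - phi x)%:E)%E.
  by rewrite integral_ge0// => x _; rewrite lee_fin; case/andP: (phi01' x).
have : (0 <= \int[iid P n]_x (phi x)%:E)%E.
  by rewrite integral_ge0// => x _; rewrite lee_fin; case/andP: (phi01 x).
move: sum1.
case: (\int[iid P n]_x (phi x)%:E)%E => [a| |]//;
  case: (\int[iid P n]_x (1 - phi x)%:E)%E => [b| |]//.
by move=> [ab1] _ _; exists a; split=> //; congr (_%:E); lra.
Qed.

(** The two signs are the bound above for phi and for 1 - phi. *)
Lemma error_sum_near1 P Q g (K s : R) phi :
  has_density P Q g -> (\int[P]_x (g x ^+ 2)%:E <= K%:E)%E -> 0 < s ->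
  is_test phi ->
  (`|error_sum P Q phi - 1| <= (s / 2 * (K ^+ n - 1) + (2 * s)^-1)%:E)%E.
Proof.
move=> gQ gK s0 tphi.
have [a [aE a'E]] := integral_test_fin P tphi.
have [b [bE b'E]] := integral_test_fin Q tphi.
have := integral_test_le gQ gK s0 tphi.
have := integral_test_le gQ gK s0 (is_test_compl tphi).
rewrite /error_sum unlock aE a'E bE b'E -!EFinD abse_EFin !lee_fin.
rewrite ler_norml => h1 h2.
by apply/andP; split; lra.
Qed.

(** The test rejecting when lr > 1 has error sum int min(1, lr) dP^n, and
    min(1, lr) <= sqrt lr, whose integral factorizes. *)
Lemma lr_test_error P Q g : has_density P Q g ->
  exists phi, is_lr_test P Q phi /\
    (error_sum P Q phi <= (\int[P]_x (Num.sqrt (g x))%:E) ^+ n)%E.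
Proof.
move=> gQ; have [mg g0 _] := gQ.
have mlr : measurable_fun [set: n.-tuple X] (prodf g) by exact: measurable_prodf.
have lr0 x : 0 <= @prodf _ _ _ n g x by exact: prodf_ge0.
pose phi (x : n.-tuple X) : R :=
  if 1 < prodf g x then 1 else if prodf g x == 1 then 0 else 0.
have phiE : phi = (fun x => if 1 < prodf g x then 1 else 0).
  by apply/funext => x; rewrite /phi; case: ifPn => //; rewrite if_same.
have mphi : measurable_fun setT phi.
  rewrite phiE; apply: measurable_fun_ifT => //.
  exact: measurable_fun_ltr.
have tphi : is_test phi.
  split=> // x; rewrite phiE; case: ifPn => _; rewrite ?lexx ?ler01//.
have [mphi' phi'01] := is_test_compl tphi.
exists phi; split.
  split=> //; exists (prodf g), 1, 0; split => //.
  exact: prodf_is_density.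
rewrite /error_sum unlock.
have msqrt : measurable_fun setT (fun y => Num.sqrt (g y)).
  apply: measurableT_comp mg; apply: continuous_measurable_fun.
  exact: sqrt_continuous.
rewrite -integral_prodf//.
rewrite (integral_iid_density gQ)//; last 2 first.
- exact/measurable_EFinP.
- by move=> x; rewrite lee_fin; case/andP: (phi'01 x).
rewrite -ge0_integralD//; last 4 first.
- by move=> x _; rewrite lee_fin; case/andP: (tphi.2 x).
- exact/measurable_EFinP.
- by move=> x _; rewrite mule_ge0// lee_fin; case/andP: (phi'01 x).
- by apply: emeasurable_funM; exact/measurable_EFinP.
apply: ge0_le_integral => //.
- move=> x _; rewrite adde_ge0 ?mule_ge0 ?lee_fin//.
  + by case/andP: (tphi.2 x).
  + by case/andP: (phi'01 x).
- by apply: emeasurable_funD; [|apply: emeasurable_funM]; exact/measurable_EFinP.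
- by apply/measurable_EFinP; exact: measurable_prodf.
move=> x _; rewrite -EFinM -EFinD lee_fin phiE.
have -> : prodf (fun y => Num.sqrt (g y)) x = Num.sqrt (prodf g x).
  rewrite /prodf; elim/big_rec2 : _ => [|i y1 y2 _ ->]; first by rewrite sqrtr1.
  by rewrite sqrtrM.
case: ltP => [lr1|lr1].
  rewrite subrr mul0r addr0 -[leLHS]sqrtr1 ler_wsqrtr//; exact: ltW.
rewrite subr0 mul1r add0r -{1}(sqr_sqrtr (lr0 x)) expr2 ler_piMr ?sqrtr_ge0//.
by rewrite -sqrtr1 ler_wsqrtr.
Qed.

End test_errors.
(** * Integrals against a density *)

Section densities.
Context (R : realType) d (X : measurableType d).
Implicit Types (P Q mu : probability X R) (f g : X -> R).

Lemma mixture_has_density (e : {i01 R}) P mu f : has_density P mu f ->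
  has_density P (mixture e P mu) (fun x => (1 - e%:num) + e%:num * f x).
Proof.
move=> [mf f0 fmu].
have e0 : 0 <= e%:num by [].
have e1 : 0 <= 1 - e%:num by rewrite subr_ge0.
split.
- by apply: measurable_funD => //; exact: measurable_funM.
- by move=> x; rewrite addr_ge0// mulr_ge0.
move=> psi mpsi psi0.
rewrite ge0_integral_measure_add// !ge0_integral_mscale//= fmu//.
rewrite -!ge0_integralZl//; last 2 first.
- by apply: emeasurable_funM => //; exact/measurable_EFinP.
- by move=> x _; rewrite mule_ge0 ?lee_fin.
rewrite -ge0_integralD//; last 4 first.
- by move=> x _; rewrite mule_ge0 ?lee_fin.
- exact: emeasurable_funM.
- by move=> x _; rewrite mule_ge0 ?lee_fin// mule_ge0 ?lee_fin.
- apply: emeasurable_funM => //; apply: emeasurable_funM => //.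
  exact/measurable_EFinP.
apply: eq_integral => x _.
rewrite (EFinD (1 - e%:num)) ge0_muleDr ?lee_fin ?mulr_ge0// EFinM.
by rewrite [(_ * psi x)%E]muleC muleCA.
Qed.

Lemma integral_density P Q g : has_density P Q g ->
  (\int[P]_x (g x)%:E = 1)%E.
Proof.
move=> [mg g0 gQ].
transitivity (\int[Q]_x (1 : \bar R))%E.
  by rewrite gQ//; apply: eq_integral => x _; rewrite mul1e.
exact: integral_prob_cst.
Qed.

(** From f^2 <= D f and int f dP = 1: the square of 1 - e + e f integrates to
    1 - e^2 + e^2 int f^2 dP. *)
Lemma integral_sqr_mixture (e : {i01 R}) P mu f D : has_density P mu f ->
  (forall x, f x <= D) ->
  (\int[P]_x (((1 - e%:num) + e%:num * f x) ^+ 2)%:E <=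
     (1 + e%:num ^+ 2 * D)%:E)%E.
Proof.
move=> fmu fD; have [mf f0 _] := fmu.
have e0 : 0 <= e%:num by [].
have e1 : 0 <= 1 - e%:num by rewrite subr_ge0.
set e' := e%:num in e0 e1 *.
have D0 : 0 <= D by apply: le_trans (fD point); exact: f0.
pose b := 2 * e' * (1 - e') + e' ^+ 2 * D.
have b0 : 0 <= b by rewrite addr_ge0// !mulr_ge0// ?sqr_ge0.
apply: (@le_trans _ _ (\int[P]_x (((1 - e') ^+ 2)%:E + b%:E * (f x)%:E))%E).
  apply: ge0_le_integral => //.
  - by move=> x _; rewrite lee_fin sqr_ge0.
  - apply/measurable_EFinP/measurable_funX.
    by apply: measurable_funD => //; exact: measurable_funM.
  - apply: emeasurable_funD => //; apply: emeasurable_funM => //.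
    exact/measurable_EFinP.
  - move=> x _; rewrite -EFinM -EFinD lee_fin /b.
    rewrite -subr_ge0; set y := _ - _.
    have -> : y = e' ^+ 2 * (f x * (D - f x)) by rewrite /y; ring.
    by rewrite mulr_ge0 ?sqr_ge0// mulr_ge0// subr_ge0.
rewrite ge0_integralD//; last 3 first.
- by move=> x _; rewrite lee_fin sqr_ge0.
- by move=> x _; rewrite mule_ge0 ?lee_fin.
- by apply: emeasurable_funM => //; exact/measurable_EFinP.
rewrite integral_prob_cst ge0_integralZl//; last 2 first.
- exact/measurable_EFinP.
- by move=> x _; rewrite lee_fin.
rewrite (integral_density fmu) mule1.
rewrite -EFinD lee_fin /b.
have := mulr_ge0 e0 e0; rewrite expr2; lra.
Qed.

(** By sqrt g <= (b + g / b) / 2, with b constant on A and b = 1 off A, the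
    affinity is bounded in terms of P A and Q A only. *)
Lemma integral_sqrt_density P Q g (A : set X) (a q : R) :
  has_density P Q g -> measurable A -> P A = a%:E -> Q A = q%:E -> 0 < q ->
  (\int[P]_x (Num.sqrt (g x))%:E <= (1 - (q - a) ^+ 2 / (4 * (q + a)))%:E)%E.
Proof.
move=> gQ mA PA QA q0; have [mg g0 gE] := gQ.
have a0 : 0 <= a by rewrite -lee_fin -PA.
have qa0 : 0 < q + a by rewrite ltr_wpDr.
pose step (b : R) (x : X) : R := b * \1_A x + \1_(~` A) x.
have step0 b x : 0 <= b -> 0 <= step b x.
  by move=> b0; rewrite addr_ge0 ?mulr_ge0.
have mstep b : measurable_fun setT (step b).
  apply: measurable_funD; last exact/measurable_indic/measurableC.
  by apply: measurable_funM => //; exact: measurable_indic.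
have int_step (S : probability X R) s b : 0 <= b -> S A = s%:E ->
    (\int[S]_x (step b x)%:E = (b * s + (1 - s))%:E)%E.
  move=> b0 SA; under eq_integral do rewrite EFinD EFinM.
  rewrite ge0_integralD//; last 3 first.
  - by move=> x _; rewrite mule_ge0 ?lee_fin.
  - by apply: emeasurable_funM => //; apply/measurable_EFinP/measurable_indic.
  - by apply/measurable_EFinP/measurable_indic/measurableC.
  rewrite ge0_integralZl_EFin//; last first.
    by apply/measurable_EFinP/measurable_indic.
  rewrite !integral_indic// ?setIT; last exact: measurableC.
  transitivity (b%:E * S A + S (~` A))%E; first by [].
  by rewrite probability_setC// SA.
(* the optimal constant on A is sqrt (q / a); this rational substitute loses
   only a constant factor in the exponent *)
pose c := 2 * q / (q + a).
have c0 : 0 < c by rewrite divr_gt0// mulr_gt0.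
have c0' := ltW c0.
have ci0 : 0 <= c^-1 by rewrite invr_ge0 ltW.
have int_gstep : (\int[P]_x ((step c^-1 x)%:E * (g x)%:E) =
    (c^-1 * q + (1 - q))%:E)%E.
  rewrite -(int_step Q q)// gE//; first exact/measurable_EFinP.
  by move=> x; rewrite lee_fin step0.
apply: (@le_trans _ _ (\int[P]_x ((2^-1)%:E * ((step c x)%:E +
     (step c^-1 x)%:E * (g x)%:E)))%E).
  apply: ge0_le_integral => //.
  - apply/measurable_EFinP; apply: measurableT_comp mg.
    apply: continuous_measurable_fun; exact: sqrt_continuous.
  - apply: emeasurable_funM => //; apply: emeasurable_funD.
      exact/measurable_EFinP.
    by apply: emeasurable_funM; exact/measurable_EFinP.
  - move=> x _; rewrite [leRHS](_ : _ =
      (2^-1 * (step c x + step c^-1 x * g x))%:E)// lee_fin.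
    suff amgm b : 0 < b -> Num.sqrt (g x) <= 2^-1 * (b + b^-1 * g x).
      rewrite /step !indicE in_setC; case: (x \in A) => /=.
        by rewrite !mulr1 !addr0; exact: amgm.
      by rewrite !mulr0 !add0r; have := amgm 1 ltr01; rewrite invr1.
    move=> b0; rewrite -[in leRHS](sqr_sqrtr (g0 x)).
    set s := Num.sqrt _.
    have -> : 2^-1 * (b + b^-1 * s ^+ 2) = (2 * b)^-1 * (b ^+ 2 + s ^+ 2).
      by field; rewrite gt_eqF.
    rewrite [leRHS]mulrC ler_pdivlMr ?mulr_gt0//.
    by have := sqr_ge0 (b - s); rewrite !expr2; lra.
rewrite ge0_integralZl//; last 2 first.
- apply: emeasurable_funD; first exact/measurable_EFinP.
  by apply: emeasurable_funM; exact/measurable_EFinP.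
- by move=> x _; rewrite adde_ge0 ?mule_ge0 ?lee_fin ?step0.
rewrite ge0_integralD//; last 4 first.
- by move=> x _; rewrite lee_fin step0.
- exact/measurable_EFinP.
- by move=> x _; rewrite mule_ge0 ?lee_fin ?step0.
- by apply: emeasurable_funM; exact/measurable_EFinP.
rewrite int_gstep (int_step P a)//.
rewrite -EFinD -EFinM lee_fin le_eqVlt; apply/orP; left; apply/eqP.
by rewrite /c; field; rewrite !gt_eqF.
Qed.



Lemma affinity_expn_le P Q g (A : set X) (a q : R) n :
  has_density P Q g -> measurable A -> P A = a%:E -> Q A = q%:E -> 0 < q ->
  ((\int[P]_x (Num.sqrt (g x))%:E) ^+ n <=
    (expR (- (n%:R * ((q - a) ^+ 2 / (4 * (q + a))))))%:E)%E.
Proof.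
move=> gQ mA PA QA q0.
have : (0 <= \int[P]_x (Num.sqrt (g x))%:E)%E.
  by rewrite integral_ge0// => x _; rewrite lee_fin sqrtr_ge0.
have := integral_sqrt_density gQ mA PA QA q0.
set y := _ / _.
case: (\int[P]_x _)%E => [s| |]//; rewrite !lee_fin => sy s0.
rewrite -EFin_expe lee_fin -mulrN expRM_natl.
apply: lerXn2r; rewrite ?nnegrE ?expR_ge0//.
by apply: (le_trans sy); have := expR_ge1Dx (- y).
Qed.

End densities.
Section density_bounds.
Context (R : realType) d (X : measurableType d).
Implicit Types (P Q : probability X R) (g : X -> R) (A : set X) (c : R).

Lemma has_density_measure P Q g A : has_density P Q g -> measurable A ->
  Q A = (\int[P]_(x in A) (g x)%:E)%E.
Proof.
move=> [mg g0 gE] mA.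
transitivity (\int[Q]_x (\1_A x)%:E)%E.
  by rewrite integral_indic// setIT.
rewrite gE//; last by apply/measurable_EFinP; exact: measurable_indic.
rewrite [RHS]integral_mkcond; apply: eq_integral => x _.
by rewrite indicE patchE; case: (x \in A); rewrite ?mul1e ?mul0e.
Qed.

Lemma has_density_measure_le P Q g A c : has_density P Q g -> measurable A ->
  (forall x, A x -> g x <= c) -> (Q A <= c%:E * P A)%E.
Proof.
move=> gQ mA gc; have [mg g0 _] := gQ.
rewrite (has_density_measure gQ mA) -(integral_cst P mA c%:E).
apply: ge0_le_integral => //.
- by move=> x _; rewrite lee_fin.
- by apply/measurable_EFinP; exact: measurable_funTS.
Qed.

Lemma has_density_measure_ge P Q g A c : has_density P Q g -> measurable A ->
  0 <= c -> (forall x, A x -> c <= g x) -> (c%:E * P A <= Q A)%E.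
Proof.
move=> gQ mA c0 gc; have [mg g0 _] := gQ.
rewrite (has_density_measure gQ mA) -(integral_cst P mA c%:E).
apply: ge0_le_integral => //.
by apply/measurable_EFinP; exact: measurable_funTS.
Qed.

End density_bounds.

(** * Quantiles of a continuous law *)

Section quantiles.
Context (R : realType) (P : probability (measurableTypeR R) R).
Context (supportP : P `[0, +oo[%classic = 1%E).
Context (continuousP : continuous (distr_fun P)).
Local Notation F := (distr_fun P).
Local Notation q := (quantile P).

Let mItv (i : interval R) : measurable [set` i]. Proof. exact: measurable_itv. Qed.

Lemma distr_funE x : P `]-oo, x]%classic = (F x)%:E.
Proof. by rewrite /distr_fun fineK// fin_num_measure. Qed.

Lemma distr_fun_homo : {homo F : x y / x <= y}.
Proof.
move=> x y xy; rewrite -lee_fin -!distr_funE le_measure ?inE//.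
by apply: subitvPr; rewrite bnd_simp.
Qed.

Lemma distr_fun0 : F 0 = 0.
Proof.
have FN x : x < 0 -> F x = 0.
  move=> x0; apply/EFin_inj; rewrite -distr_funE.
  apply/eqP; rewrite -measure_le0.
  have <- : P (~` `[0, +oo[%classic) = 0%E.
    by rewrite probability_setC// supportP subee.
  apply: le_measure; rewrite ?inE//; first exact: measurableC.
  move=> y /=; rewrite !in_itv/= andbT => yx.
  by apply/negP; rewrite -ltNge (le_lt_trans yx).
have F0 : F x @[x --> 0^'-] --> F 0.
  by apply: cvg_at_left_filter; exact: continuousP.
have F0' : F x @[x --> 0^'-] --> (0 : R).
  apply: cvg_near_cst; near=> x; apply: FN; near: x; exact: nbhs_left_lt.
exact: (cvg_unique _ F0 F0').
Unshelve. all: by end_near. Qed.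

Lemma distr_fun_reaches u a : u < 1 -> exists2 b, a <= b & u <= F b.
Proof.
move=> u1; pose A (n : nat) : set R := `]-oo, n%:R]%classic.
have mA n : measurable (A n) by exact: mItv.
have Acvg : P (A n) @[n --> \oo] --> 1%E.
  have AT : \bigcup_n A n = setT.
    apply/seteqP; split=> // x _; exists (Num.bound `|x|) => //.
    rewrite /A/= in_itv/=; apply: (le_trans (ler_norm x)).
    exact/ltW/archi_boundP.
  have <- : P (\bigcup_n A n) = 1%E by rewrite AT; exact: probability_setT.
  have mcup : measurable (\bigcup_n A n) by rewrite AT.
  apply: (@nondecreasing_cvg_mu _ _ R P A mA mcup) => m n mn; apply/subsetPset => x.
  by rewrite /A/= !in_itv/= => /le_trans; apply; rewrite ler_nat.
near \oo => n; exists n%:R.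
  by near: n; exact: nbhs_infty_ger.
apply/ltW; near: n.
exact: (cvgr_gt _ (fine_cvg Acvg)).
Unshelve. all: by end_near. Qed.

Lemma distr_fun_ivt u a : 0 <= a -> F a <= u < 1 ->
  exists2 x, a <= x & F x = u.
Proof.
move=> a0 /andP[au u1].
have [b ab ub] := distr_fun_reaches a u1.
have [|x] := @IVT R F a b u ab (continuous_subspaceT continuousP).
  by rewrite min_l ?max_r ?distr_fun_homo// au ub.
by rewrite in_itv/= => /andP[ax _] Fx; exists x.
Unshelve. all: by end_near. Qed.

Lemma quantile_set_nonempty u : 0 <= u < 1 ->
  [set x | 0 <= x /\ u <= F x] !=set0.
Proof.
move=> u01; have [|x x0 Fx] := @distr_fun_ivt u 0 (lexx _).
  by rewrite distr_fun0.
by exists x; split; rewrite ?Fx.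
Qed.

Lemma quantile_set_lbound u : has_lbound [set x | 0 <= x /\ u <= F x].
Proof. by exists 0 => x []. Qed.

Lemma quantile_le u x : 0 <= x -> u <= F x -> q u <= x.
Proof. by move=> x0 ux; apply: ge_inf; [exact: quantile_set_lbound|split]. Qed.

Lemma quantile_ge0 u : 0 <= u < 1 -> 0 <= q u.
Proof.
by move=> u01; apply: lb_le_inf; [exact: quantile_set_nonempty|move=> x []].
Qed.

Lemma quantile0 : q 0 = 0.
Proof.
apply/eqP; rewrite eq_le quantile_le ?distr_fun0// quantile_ge0//.
by rewrite lexx ltr01.
Qed.

Lemma quantile_homo u v : 0 <= u -> u <= v -> v < 1 -> q u <= q v.
Proof.
move=> u0 uv v1; apply: lb_le_inf.
  by apply: quantile_set_nonempty; rewrite (le_trans u0).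
by move=> x [x0 vx]; apply: quantile_le => //; exact: le_trans vx.
Qed.

(** Both inequalities come from the intermediate value theorem: a point where
    F takes the value u bounds q u from above, and if F (q u) < u then a point
    where F takes a value in between would be a larger lower bound of the set
    whose infimum is q u. *)
Lemma distr_fun_quantile u : 0 <= u < 1 -> F (q u) = u.
Proof.
move=> u01; apply/eqP; rewrite eq_le; apply/andP; split.
  have [|x x0 Fx] := @distr_fun_ivt u 0 (lexx _); first by rewrite distr_fun0.
  by rewrite -[leRHS]Fx distr_fun_homo// quantile_le// Fx.
rewrite leNgt; apply/negP => Fqu.
pose y := (F (q u) + u) / 2.
have [x qx Fx] : exists2 x, q u <= x & F x = y.
  apply: distr_fun_ivt; first exact: quantile_ge0.
  by case/andP: u01 => ? ?; apply/andP; split; rewrite /y; lra.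
have qx' : q u < x.
  rewrite lt_neqAle qx andbT; apply/eqP => qxE.
  by move: Fx; rewrite -qxE /y; lra.
suff : x <= q u by rewrite leNgt qx'.
apply: lb_le_inf; first exact: quantile_set_nonempty.
move=> z [z0 uz]; rewrite leNgt; apply/negP => /ltW/distr_fun_homo.
by rewrite Fx /y; lra.
Qed.

Lemma quantile_gt0 u : 0 < u < 1 -> 0 < q u.
Proof.
move=> /andP[u0 u1]; rewrite lt_neqAle eq_sym quantile_ge0 ?(ltW u0)// andbT.
apply/eqP => qu0; have := @distr_fun_quantile u.
by rewrite qu0 distr_fun0 (ltW u0) u1 => /(_ isT) u0E; rewrite -u0E ltxx in u0.
Qed.

End quantiles.


(** * The exponential family along the quantiles of P_0 *)

Section exponential_family.
Context (R : realType) (P : R -> probability (measurableTypeR R) R).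
Context (T C L : R -> R) (eta p : R).
Context (supportP : forall v : R, 0 <= v -> P v `[0, +oo[%classic = 1%E).
Context (continuousP : forall v : R, 0 <= v -> continuous (distr_fun (P v))).
Context (densityP : forall v : R, 0 <= v ->
  is_density (P v) (P 0) `[0, +oo[ (fun x => C v * expR (v * T x))).
Context (C_gt0 : forall v : R, 0 <= v -> 0 < C v).
Context (eta_gt0 : 0 < eta).
Context (T_decr : forall x y : R, 0 <= x -> x < y -> y <= eta -> T y < T x).
Context (T_eta : forall x : R, eta <= x -> T x <= T eta).
Context (p_gt0 : 0 < p) (L_sv : slowly_varying L).
Context (T_quantile : \forall u \near 0^'+,
  T (quantile (P 0) 0) - T (quantile (P 0) u) = u `^ p^-1 * L u^-1).

Local Notation F := (distr_fun (P 0)).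
Local Notation q := (quantile (P 0)).

Let suppP0 := supportP (lexx 0).
Let contP0 := continuousP (lexx 0).

Definition gap (u : R) : R := T 0 - T (q u).
Definition peak (v : R) : R := C v * expR (v * T 0).

Lemma T_antitone x y : 0 <= x -> x <= y -> x <= eta -> T y <= T x.
Proof.
move=> x0; rewrite le_eqVlt => /orP[/eqP ->//|xy] xeta.
have [yeta|etay] := leP y eta; first exact/ltW/T_decr.
apply: (le_trans (T_eta (ltW etay))).
move: xeta; rewrite le_eqVlt => /orP[/eqP ->//|xeta].
exact/ltW/T_decr.
Qed.

Lemma T_lt0 x : 0 < x -> T x < T 0.
Proof.
move=> x0; have [xeta|etax] := leP x eta; first exact: T_decr.
by apply: (le_lt_trans (T_eta (ltW etax))); exact: T_decr.
Qed.

Lemma T_le0 x : 0 <= x -> T x <= T 0.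
Proof. by move=> x0; apply: T_antitone => //; exact: ltW. Qed.

Lemma gap_gt0 u : 0 < u < 1 -> 0 < gap u.
Proof. by move=> u01; rewrite subr_gt0 T_lt0// quantile_gt0. Qed.

Lemma near_gap_gt0 : \forall u \near 0^'+, 0 < gap u.
Proof.
near=> u; apply: gap_gt0; apply/andP; split; near: u.
  exact: nbhs_right_gt.
exact: nbhs_right_lt.
Unshelve. all: by end_near. Qed.

Lemma gap_halving : gap (u / 2) / gap u @[u --> 0^'+] --> 2 `^ (- p^-1).
Proof.
apply: (slowly_varying_halving L_sv _).1; move: T_quantile.
by rewrite quantile0.
Qed.

(** If P_0 had no mass in [0, eta] then gap would be bounded below by
    T 0 - T eta > 0, against its regular variation with positive index. *)
Lemma distr_fun_eta_gt0 : 0 < F eta.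
Proof.
rewrite ltNge; apply/negP => Feta0.
have c0 : 0 < T 0 - T eta by rewrite subr_gt0 T_lt0.
apply: (regularly_varying_small _ near_gap_gt0 gap_halving c0).
  by rewrite invr_gt0.
near=> u; rewrite /gap lerB// T_eta// leNgt; apply/negP => /ltW qeta.
have u0 : 0 < u by near: u; exact: nbhs_right_gt.
have : F (q u) <= 0 by apply: le_trans Feta0; exact: distr_fun_homo.
rewrite distr_fun_quantile//; first by rewrite leNgt u0.
by rewrite (ltW u0)/=; near: u; exact: nbhs_right_lt.
Unshelve. all: by end_near. Qed.

Lemma quantile_le_eta u : u <= F eta -> q u <= eta.
Proof. by move=> ueta; apply: quantile_le => //; exact: ltW. Qed.

Lemma gap_homo u v : 0 <= u -> u <= F eta -> u <= v -> v < 1 -> gap u <= gap v.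
Proof.
move=> u0 ueta uv v1; rewrite /gap lerB// T_antitone//.
- by apply: quantile_ge0 => //; rewrite u0 (le_lt_trans uv).
- exact: quantile_homo.
- exact: quantile_le_eta.
Qed.

(** In terms of u = exp (- s), so that the later choices of exponents become
    linear conditions on ln n. *)
Lemma gap_bounds kappa : 0 < kappa -> \forall s \near +oo,
  expR (- ((p^-1 + kappa) * s)) <= gap (expR (- s)) <=
    expR (- ((p^-1 - kappa) * s)).
Proof.
move=> k0.
have H : \forall u \near 0^'+,
    u `^ (p^-1 + kappa) <= gap u <= u `^ (p^-1 - kappa).
  apply: regularly_varying_bounds => //; first exact: near_gap_gt0.
    near=> v.
    have veta : v <= F eta.
      by near: v; apply: nbhs_right_le; exact: distr_fun_eta_gt0.
    have v1 : v < 1 by near: v; exact: nbhs_right_lt.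
    move=> u /andP[u0 uv]; apply: gap_homo => //; first exact: ltW.
    exact: le_trans veta.
  exact: gap_halving.
have [u0 u00 u0P] := (at0P _).1 H.
near=> s.
have /andP[] : expR (- s) `^ (p^-1 + kappa) <= gap (expR (- s)) <=
    expR (- s) `^ (p^-1 - kappa).
  apply: u0P; rewrite expR_gt0/=; near: s.
  have /cvgr_le := @cvgr_expR R; exact.
rewrite -!expRM !mulNr ![s * _]mulrC => -> ->//.
Unshelve. all: by end_near. Qed.

(** The negative reals are a null set; giving them the value at 0 makes the
    bounds on the density below valid on the whole line. *)
Definition density (v x : R) : R := C v * expR (v * T (Num.max 0 x)).

Lemma densityE v : 0 <= v -> has_density (P 0) (P v) (density v).
Proof.
move=> v0; have [PvP0 mf fae] := densityP v0.
have mden : measurable_fun setT (density v).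
  rewrite (_ : density v = (fun x => C v * expR (v * T x)) \o Num.max 0)//.
  apply: (measurable_comp _ _ mf) => //.
    by move=> _ [x _ <-] /=; rewrite in_itv/= andbT le_max lexx.
  exact: measurable_maxr.
have den0 x : 0 <= density v x by rewrite mulr_ge0 ?expR_ge0// ltW// C_gt0.
split=> // psi mpsi psi0.
have supp : {ae P 0, forall x, `[0, +oo[%classic x}.
  exists (~` `[0, +oo[%classic); split.
  - exact: measurableC.
  - by rewrite probability_setC// suppP0 subee.
  - by [].
have aeE : ae_eq (P 0) setT (Radon_Nikodym_SigmaFinite.f (P v) (P 0))
    (EFin \o density v).
  have := @ae_eq_Radon_Nikodym_SigmaFinite _ _ _ (P v) (P 0) PvP0 _ measurableT.
  move: fae supp; apply: filterS3 => x /= + x0 /(_ I) -> _ => /(_ x0) ->.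
  move: x0; rewrite in_itv/= andbT => x0.
  by rewrite /density max_r.
rewrite -(Radon_Nikodym_SigmaFinite.change_of_variables PvP0)//.
apply: ae_eq_integral => //.
- apply: emeasurable_funM => //.
  by have := Radon_Nikodym_SigmaFinite.f_integrable PvP0; apply: measurable_int.
- by apply: emeasurable_funM => //; exact/measurable_EFinP.
- by move: aeE; apply: filterS => x /= + _ => ->.
Qed.

Lemma peak_gt0 v : 0 <= v -> 0 < peak v.
Proof. by move=> v0; rewrite mulr_gt0 ?expR_gt0// C_gt0. Qed.

Lemma density_le_peak v x : 0 <= v -> density v x <= peak v.
Proof.
move=> v0; rewrite ler_pM2l ?C_gt0// ler_expR ler_wpM2l// T_le0//.
by rewrite le_max lexx.
Qed.

Lemma peak_gapE v u : C v * expR (v * T (q u)) = peak v * expR (- (v * gap u)).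
Proof.
rewrite /peak -mulrA -expRD /gap; congr (_ * expR _); ring.
Qed.

Lemma density_tail v u x : 0 <= v -> 0 <= u < 1 -> u <= F eta ->
  q u <= x -> density v x <= peak v * expR (- (v * gap u)).
Proof.
move=> v0 u01 ueta qx; rewrite -peak_gapE ler_pM2l ?C_gt0// ler_expR.
rewrite ler_wpM2l// T_antitone//; first exact: quantile_ge0.
  by rewrite le_max qx orbT.
exact: quantile_le_eta.
Qed.

Lemma density_head v u x : 0 <= v -> 0 <= u < 1 -> u <= F eta ->
  x <= q u -> peak v * expR (- (v * gap u)) <= density v x.
Proof.
move=> v0 u01 ueta xq; rewrite -peak_gapE ler_pM2l ?C_gt0// ler_expR.
have q0 : 0 <= q u by exact: quantile_ge0.
have xq' : Num.max 0 x <= q u by rewrite ge_max q0.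
rewrite ler_wpM2l// T_antitone//; first by rewrite le_max lexx.
by apply: (le_trans xq'); exact: quantile_le_eta.
Qed.

Lemma measure_quantile u : 0 <= u < 1 -> P 0 `]-oo, q u]%classic = u%:E.
Proof. by move=> u01; rewrite distr_funE distr_fun_quantile. Qed.

(** On [0, q u], of P_0-mass u, the density is at least its value at q u, and
    P_v has total mass 1. *)
Lemma peak_mul_le1 v u : 0 <= v -> 0 <= u < 1 -> u <= F eta ->
  peak v * expR (- (v * gap u)) * u <= 1.
Proof.
move=> v0 u01 ueta; rewrite -lee_fin EFinM -(measure_quantile u01).
apply: (@le_trans _ _ (P v `]-oo, q u]%classic)); last exact: probability_le1.
apply: (has_density_measure_ge (densityE v0)) => //.
  by rewrite mulr_ge0 ?expR_ge0// ltW// peak_gt0.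
by move=> x; rewrite /= in_itv/= => xq; exact: density_head.
Qed.

Lemma tail_mass v u : 0 <= v -> 0 <= u < 1 -> u <= F eta ->
  (P v (~` `]-oo, q u]%classic) <= (peak v * expR (- (v * gap u)))%:E)%E.
Proof.
move=> v0 u01 ueta; set c := _ * _.
have c0 : 0 <= c by rewrite mulr_ge0 ?expR_ge0// ltW// peak_gt0.
apply: (@le_trans _ _ (c%:E * P 0 (~` `]-oo, q u]%classic))%E).
  apply: (has_density_measure_le (densityE v0)); first exact: measurableC.
  move=> x /=; rewrite in_itv/= => /negP; rewrite -ltNge => /ltW qx.
  exact: density_tail.
rewrite -[leRHS]mule1 lee_wpmul2l ?lee_fin//.
by apply: probability_le1; exact: measurableC.
Qed.

(** The total mass of P_v is split at q u: the density is at most peak v on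
    the left, and at most its value at q u on the right. *)
Lemma peak_mul_ge1 v u : 0 <= v -> 0 <= u < 1 -> u <= F eta ->
  1 <= peak v * (u + expR (- (v * gap u))).
Proof.
move=> v0 u01 ueta; rewrite mulrDr -lee_fin EFinD.
set A := `]-oo, q u]%classic.
have mA : measurable (A : set (measurableTypeR R)) by exact: measurable_itv.
have <- : (P v A + P v (~` A) = 1)%E.
  rewrite probability_setC// addeC subeK//.
  by rewrite fin_num_measure.
apply: leeD; last exact: tail_mass.
rewrite EFinM -(measure_quantile u01).
apply: (has_density_measure_le (densityE v0)) => // x _.
exact: density_le_peak.
Qed.

(** * Growth of the normalizing constant *)

Lemma near_quantile_small : \forall s \near +oo,
  [/\ 0 < expR (- s), expR (- s) <= F eta & expR (- s) < 1 / 2].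
Proof.
near=> s; split; first exact: expR_gt0.
  by near: s; have /cvgr_le := @cvgr_expR R; apply; exact: distr_fun_eta_gt0.
by near: s; have /cvgr_lt := @cvgr_expR R; apply; lra.
Unshelve. all: by end_near. Qed.

(** peak_mul_le1 at u = v^-a with a slightly larger than p, so that
    v * gap u <= 1. *)
Lemma ln_peak_le kappa : 0 < kappa ->
  \forall l \near +oo, ln (peak (expR l)) <= (p + kappa) * l.
Proof.
(* k' is chosen to make the exponent (1/p - k') a equal to 1 *)
move=> k0; have p0 := p_gt0; pose a := p + kappa / 2; pose k' := kappa / (2 * p) / a.
have a0 : 0 < a by rewrite /a; lra.
have k'0 : 0 < k' by rewrite !divr_gt0// mulr_gt0.
have ak' : (p^-1 - k') * a = 1.
  by rewrite /k' /a; field; rewrite !gt_eqF//; lra.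
have H := near_pinfty_mul a0 (gap_bounds k'0).
have H2 := near_pinfty_mul a0 near_quantile_small.
near=> l.
have [u0 ueta u1] : [/\ 0 < expR (- (a * l)), expR (- (a * l)) <= F eta &
  expR (- (a * l)) < 1 / 2] by near: l.
have /andP[_] : expR (- ((p^-1 + k') * (a * l))) <= gap (expR (- (a * l))) <=
    expR (- ((p^-1 - k') * (a * l))) by near: l.
rewrite mulrA ak' mul1r => gl.
have v0 := expR_ge0 l.
have /(_ v0) := @peak_mul_le1 (expR l) (expR (- (a * l))).
rewrite (ltW u0) => /(_ _ ueta).
have -> : expR (- (a * l)) < 1 by lra.
move=> /(_ isT).
have := peak_gt0 v0; move: (peak (expR l)) => pv pv0.
rewrite -ler_ln ?posrE ?mulr_gt0 ?expR_gt0//.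
rewrite !lnM ?posrE ?mulr_gt0 ?expR_gt0// !expRK ln1.
have vg : expR l * gap (expR (- (a * l))) <= 1.
  apply: (@le_trans _ _ (expR l * expR (- l))); first by rewrite ler_wpM2l.
  by rewrite -expRD subrr expR0.
have lk : 2 / kappa <= l by near: l; apply: nbhs_pinfty_ge; exact: num_real.
move: lk; rewrite ler_pdivrMr// /a => lk.
by move: vg; set y := expR l * _; lra.
Unshelve. all: by end_near. Qed.

(** peak_mul_ge1 at u = v^-a with a slightly smaller than p, so that
    exp (- v * gap u) <= u. *)
Lemma ln_peak_ge kappa : 0 < kappa ->
  \forall l \near +oo, (p - kappa) * l <= ln (peak (expR l)).
Proof.
move=> k0; have p0 := p_gt0; pose k1 := Num.min kappa p.
(* the minimum with p keeps the exponent a positive *)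
have k10 : 0 < k1 by rewrite lt_min k0.
have k1p : k1 <= p by rewrite ge_min lexx orbT.
have k1k : k1 <= kappa by rewrite ge_min lexx.
pose a := p - k1 / 2; pose c := k1 / (4 * p); pose k' := c / a.
have a0 : 0 < a by rewrite /a; lra.
have c0 : 0 < c by rewrite divr_gt0// mulr_gt0.
have k'0 : 0 < k' by rewrite divr_gt0.
have ak' : (p^-1 + k') * a = 1 - c.
  by rewrite /k' /c /a; field; rewrite !gt_eqF//; lra.
have H := near_pinfty_mul a0 (gap_bounds k'0).
have H2 := near_pinfty_mul a0 near_quantile_small.
have H3 := near_linear_le_expR a c0.
near=> l.
have [u0 ueta u1] : [/\ 0 < expR (- (a * l)), expR (- (a * l)) <= F eta &
  expR (- (a * l)) < 1 / 2] by near: l.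
have /andP[+ _] : expR (- ((p^-1 + k') * (a * l))) <= gap (expR (- (a * l))) <=
    expR (- ((p^-1 - k') * (a * l))) by near: l.
rewrite mulrA ak' => gl.
have v0 := expR_ge0 l.
have /(_ v0) := @peak_mul_ge1 (expR l) (expR (- (a * l))).
rewrite (ltW u0) => /(_ _ ueta).
have -> : expR (- (a * l)) < 1 by lra.
move=> /(_ isT) ge1.
move: ge1; have := peak_gt0 v0; move: (peak (expR l)) => pv pk ge1.
have al : a * l <= expR l * gap (expR (- (a * l))).
  have h3 : a * l <= expR (c * l) by near: l.
  apply: (le_trans h3).
  apply: (@le_trans _ _ (expR l * expR (- ((1 - c) * l)))); last first.
    by rewrite ler_wpM2l.
  by rewrite -expRD le_eqVlt; apply/orP; left; apply/eqP; congr expR; ring.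
have {}ge1 : 1 <= pv * (2 * expR (- (a * l))).
  have small : expR (- (expR l * gap (expR (- (a * l))))) <= expR (- (a * l)).
    by rewrite ler_expR lerN2.
  by apply: (le_trans ge1); rewrite ler_pM2l//; lra.
have {ge1} : ln 1 <= ln (pv * (2 * expR (- (a * l)))).
  by rewrite ler_ln ?posrE// !mulr_gt0.
rewrite ln1 lnM ?posrE ?mulr_gt0// lnM ?posrE// expRK => ge1.
have ln2 : ln 2 < 2 :> R by exact: ln_sublinear.
have lk : 4 / k1 <= l by near: l; apply: nbhs_pinfty_ge; exact: num_real.
move: lk; rewrite ler_pdivrMr// /a => lk.
have l0 : 0 < l by near: l; apply: nbhs_pinfty_gt; exact: num_real.
have : k1 * l <= kappa * l by rewrite ler_wpM2r// ltW.
by move: ge1; rewrite /a; lra.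
Unshelve. all: by end_near. Qed.

(** * Asymptotics of h_n *)

Context (r : R) (r_gt0 : 0 < r).
Local Notation theta n := (n%:R `^ r).
Local Notation hn :=
  (h (P 0) (fun n x => C (theta n) * expR (theta n * T x))).

Lemma powR_natE (n : nat) (a : R) : (0 < n)%N ->
  n%:R `^ a = expR (a * ln n%:R) :> R.
Proof. by move=> n0; rewrite /powR pnatr_eq0 gtn_eqF. Qed.

Lemma near_nat_gt0 : \forall n \near \oo, (0 < n)%N.
Proof. by exists 1%N. Qed.

Lemma ln_tilt u v : 0 <= v ->
  ln (C v * expR (v * T (q u))) = ln (peak v) - v * gap u.
Proof.
move=> v0; rewrite peak_gapE lnM ?posrE ?expR_gt0 ?expRK// peak_gt0//.
Qed.

Lemma h_maxE n t : hn n t = ln (peak (theta n)) +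
  Num.max (- (theta n * gap (n%:R `^ (- t))))
          (- (theta n * gap (1 - n%:R `^ (- t)))).
Proof.
have th0 : 0 <= theta n by exact: powR_ge0.
rewrite /h /h1 /h2 (ln_tilt (n%:R `^ (- t)) th0).
by rewrite (ln_tilt (1 - n%:R `^ (- t)) th0) addr_maxr.
Qed.

Lemma near_ln_peak kappa : 0 < kappa -> \forall n \near \oo,
  (r * p - kappa) * ln n%:R <= ln (peak (theta n)) <= (r * p + kappa) * ln n%:R.
Proof.
move=> k0; have kr : 0 < kappa / r by rewrite divr_gt0.
have := near_ln_nat (near_pinfty_mul r_gt0 (ln_peak_le kr)).
have := near_ln_nat (near_pinfty_mul r_gt0 (ln_peak_ge kr)).
move: near_nat_gt0; apply: filterS3 => n n0.
have rN0 : r != 0 by rewrite gt_eqF.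
rewrite -(powR_natE _ n0).
have -> : (p - kappa / r) * (r * ln n%:R) = (r * p - kappa) * ln n%:R by field.
have -> : (p + kappa / r) * (r * ln n%:R) = (r * p + kappa) * ln n%:R by field.
by move=> -> ->.
Qed.

Lemma level_bounds n (t : R) : (1 < n)%N -> ln 2 / ln n%:R <= t ->
  0 < n%:R `^ (- t) <= 2^-1.
Proof.
move=> n1; have n0 : (0 < n)%N by exact: ltnW.
have ln0 : 0 < ln n%:R :> R by rewrite ln_gt0// ltr1n.
rewrite ler_pdivrMr// => tn.
rewrite powR_gt0 ?ltr0n//= powR_natE// mulNr expRN lef_pV2 ?posrE ?expR_gt0//.
by rewrite -[leLHS]lnK ?posrE// ler_expR.
Qed.

Lemma near_h_le kappa : 0 < kappa -> \forall n \near \oo,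
  forall t, ln 2 / ln n%:R <= t -> hn n t <= (r * p + kappa) * ln n%:R.
Proof.
move=> k0; have H := near_ln_peak k0; near=> n => t tn.
have n1 : (1 < n)%N by near: n; exists 2%N.
have /andP[_ pk] : (r * p - kappa) * ln n%:R <= ln (peak (theta n)) <=
  (r * p + kappa) * ln n%:R by near: n.
rewrite h_maxE; apply: le_trans pk.
have /andP[u0 u1] := level_bounds n1 tn.
rewrite gerDl ge_max !oppr_le0 !mulr_ge0 ?powR_ge0// ltW// gap_gt0//;
  by apply/andP; split; lra.
Unshelve. all: by end_near. Qed.

(** For a < r p the product n^r * gap (n^-a) is a positive power of n, which
    dominates the logarithm of the peak.  This bounds the density beyond
    q (n^-a), and with it the mass of the signal there. *)
Lemma near_tilt_decay a : 0 < a -> a < r * p -> \forall n \near \oo,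
  forall u, n%:R `^ (- a) <= u < 1 ->
  ln (peak (theta n)) - theta n * gap u <= - ln n%:R.
Proof.
move=> a0 arp; have p0 := p_gt0; have r0 := r_gt0.
pose c := (r - a / p) / 2; pose k' := c / a.
have c0 : 0 < c by rewrite divr_gt0// subr_gt0 ltr_pdivrMr.
have k'0 : 0 < k' by rewrite divr_gt0.
have ak' : (p^-1 + k') * a = r - c.
  have aN0 : a != 0 by rewrite gt_eqF.
  rewrite mulrDl /k' divfK// /c; field; exact: lt0r_neq0.
have H := near_ln_nat (near_pinfty_mul a0 (gap_bounds k'0)).
have H2 := near_ln_nat (near_pinfty_mul a0 near_quantile_small).
have H3 := near_ln_nat (near_linear_le_expR (r * p + 2) c0).
have H4 := near_ln_peak ltr01.
near=> n => u /andP[nu u1].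
have n1 : (1 < n)%N by near: n; exists 2%N.
have n0 : (0 < n)%N by exact: ltnW.
have [v0 veta v1] : [/\ 0 < expR (- (a * ln n%:R)),
  expR (- (a * ln n%:R)) <= F eta & expR (- (a * ln n%:R)) < 1 / 2] by near: n.
have /andP[+ _] : expR (- ((p^-1 + k') * (a * ln n%:R))) <=
    gap (expR (- (a * ln n%:R))) <=
    expR (- ((p^-1 - k') * (a * ln n%:R))) by near: n.
rewrite mulrA ak' => gl.
have /andP[_ pk] : (r * p - 1) * ln n%:R <= ln (peak (theta n)) <=
  (r * p + 1) * ln n%:R by near: n.
have h3 : (r * p + 2) * ln n%:R <= expR (c * ln n%:R) by near: n.
move: nu; rewrite powR_natE// mulNr => nu.
have : expR (c * ln n%:R) <= theta n * gap u.
  apply: (@le_trans _ _ (theta n * gap (expR (- (a * ln n%:R))))); last first.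
    by rewrite ler_wpM2l ?powR_ge0// gap_homo// ltW.
  apply: (@le_trans _ _ (theta n * expR (- ((r - c) * ln n%:R)))); last first.
    by rewrite ler_wpM2l ?powR_ge0.
  rewrite powR_natE// -expRD le_eqVlt; apply/orP; left; apply/eqP.
  by congr expR; ring.
by move: pk h3; set y := _ * gap _; lra.
Unshelve. all: by end_near. Qed.

(** Both quantile levels n^-t and 1 - n^-t lie in [n^-a, 1[ for
    a = r p - kappa, in the range of near_tilt_decay. *)
Lemma near_h_le0 kappa : 0 < kappa -> \forall n \near \oo,
  forall t, ln 2 / ln n%:R <= t -> t <= r * p - kappa -> hn n t <= 0.
Proof.
move=> k0; pose a := r * p - kappa.
have [a0|a0] := leP a 0.
  near=> n => t tn ta.
  have n1 : (1 < n)%N by near: n; exists 2%N.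
  have : 0 < t.
    by apply: lt_le_trans tn; rewrite divr_gt0// ln_gt0 ?ltr1n.
  by rewrite ltNge (le_trans ta).
have arp : a < r * p by rewrite /a; lra.
have H := near_tilt_decay a0 arp.
have H2 := near_ln_nat (near_pinfty_mul a0 near_quantile_small).
near=> n => t tn ta.
have n1 : (1 < n)%N by near: n; exists 2%N.
have n0 : (0 < n)%N by exact: ltnW.
have ln0 : 0 < ln n%:R :> R by rewrite ln_gt0// ltr1n.
have decay : forall u, n%:R `^ (- a) <= u < 1 ->
  ln (peak (theta n)) - theta n * gap u <= - ln n%:R by near: n.
have [_ _ v1] : [/\ 0 < expR (- (a * ln n%:R)),
  expR (- (a * ln n%:R)) <= F eta & expR (- (a * ln n%:R)) < 1 / 2] by near: n.
rewrite -mulNr -powR_natE// in v1.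
have /andP[u0 u1] := level_bounds n1 tn.
have ua : n%:R `^ (- a) <= n%:R `^ (- t).
  by rewrite ler_powR ?ler1n// lerN2.
have d1 := decay (n%:R `^ (- t)); have d2 := decay (1 - n%:R `^ (- t)).
rewrite h_maxE addr_maxr ge_max; apply/andP; split.
  by apply: le_trans (d1 _) _; [apply/andP; split; lra|lra].
by apply: le_trans (d2 _) _; [apply/andP; split; lra|lra].
Unshelve. all: by end_near. Qed.

(** At the level n^-t with t > r p the exponent n^r * gap (n^-t) is at most 1,
    so the density is of the order of its peak. *)
Lemma near_h_ge kappa : 0 < kappa -> \forall n \near \oo,
  forall t, r * p + kappa <= t -> (r * p - kappa) * ln n%:R <= hn n t.
Proof.
move=> k0; have p0 := p_gt0; have r0 := r_gt0.
have rp0 : 0 < r * p by rewrite mulr_gt0.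
pose a := r * p + kappa.
have a0 : 0 < a by rewrite /a; lra.
pose c := kappa / p; pose k' := c / a.
have c0 : 0 < c by rewrite divr_gt0.
have k'0 : 0 < k' by rewrite divr_gt0.
have k20 : 0 < kappa / 2 by rewrite divr_gt0.
have ak' : (p^-1 - k') * a = r.
  have aN0 : a != 0 by rewrite gt_eqF.
  rewrite mulrBl /k' divfK// /c /a; field; exact: lt0r_neq0.
have H := near_ln_nat (near_pinfty_mul a0 (gap_bounds k'0)).
have H2 := near_ln_nat (near_pinfty_mul a0 near_quantile_small).
have H3 : \forall n \near \oo, 2 / kappa <= ln (n%:R : R).
  apply: (@near_ln_nat _ (fun l => 2 / kappa <= l)).
  by apply: nbhs_pinfty_ge; exact: num_real.
have H4 := near_ln_peak k20.
near=> n => t ta.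
have n1 : (1 < n)%N by near: n; exists 2%N.
have n0 : (0 < n)%N by exact: ltnW.
have l0 : 0 < ln n%:R :> R by rewrite ln_gt0// ltr1n.
have [u0 ueta u1] : [/\ 0 < expR (- (a * ln n%:R)), expR (- (a * ln n%:R)) <= F eta &
  expR (- (a * ln n%:R)) < 1 / 2] by near: n.
have /andP[_ +] : expR (- ((p^-1 + k') * (a * ln n%:R))) <= gap (expR (- (a * ln n%:R))) <=
    expR (- ((p^-1 - k') * (a * ln n%:R))) by near: n.
rewrite mulrA ak' => gl.
have /andP[pk _] : (r * p - kappa / 2) * ln n%:R <= ln (peak (theta n)) <=
  (r * p + kappa / 2) * ln n%:R by near: n.
have lk : 2 / kappa <= ln n%:R by near: n.
set l : R := ln n%:R in l0 u0 ueta u1 gl pk lk *.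
have ul : n%:R `^ (- t) <= expR (- (a * l)).
  by rewrite powR_natE// ler_expR mulNr lerN2 ler_wpM2r// ltW.
have vg : theta n * gap (n%:R `^ (- t)) <= 1.
  apply: (@le_trans _ _ (theta n * gap (expR (- (a * l))))).
    rewrite ler_wpM2l ?powR_ge0// gap_homo ?powR_ge0//.
      exact: le_trans ueta.
    by apply: lt_trans u1 _; lra.
  apply: (@le_trans _ _ (theta n * expR (- (r * l)))).
    by rewrite ler_wpM2l ?powR_ge0.
  by rewrite powR_natE// -expRD subrr expR0.
move: lk; rewrite ler_pdivrMr// => lk.
rewrite h_maxE.
have : - (theta n * gap (n%:R `^ (- t))) <= Num.max
  (- (theta n * gap (n%:R `^ (- t)))) (- (theta n * gap (1 - n%:R `^ (- t)))).
  by rewrite le_max lexx.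
by move: vg; set y := _ * gap _; set z := Num.max _ _; lra.
Unshelve. all: by end_near. Qed.

Local Notation bs := ((Num.min (r * p) 1 + 1) / 2).

(** * The limiting shape of h_n *)

Lemma min_half_lip (x y : R) : x <= y ->
  Num.min x 1 / 2 <= Num.min y 1 / 2 <= Num.min x 1 / 2 + (y - x) / 2.
Proof. by rewrite /Num.min; case: ltP => ?; case: ltP => ? ?; lra. Qed.

(** The whole interval [r p + delta / 3, r p + 2 delta / 3] belongs to the set
    for n large. *)
Lemma h_score_liminf delta : 0 < delta ->
  (0 < limn_einf (fun n : nat => lebesgue_measure
    [set t : R | ln 2 / ln n%:R <= t /\
       bs - delta - 2^-1 <= hn n t / ln n%:R - t + Num.min t 1 / 2]%R))%E.
Proof.
move=> d0; pose k := delta / 3; have k0 : 0 < k by rewrite divr_gt0.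
have rp0 : 0 < r * p by rewrite mulr_gt0.
apply: (@lt_le_trans _ _ k%:E); first by rewrite lte_fin.
apply: limn_einf_ge.
have H := near_h_ge k0.
have H2 : \forall n \near \oo, ln 2 / k <= ln (n%:R : R).
  apply: (@near_ln_nat _ (fun l => ln 2 / k <= l)).
  by apply: nbhs_pinfty_ge; exact: num_real.
near=> n.
have n1 : (1 < n)%N by near: n; exists 2%N.
have ln0 : 0 < ln n%:R :> R by rewrite ln_gt0// ltr1n.
have hr : forall t, r * p + k <= t -> (r * p - k) * ln n%:R <= hn n t.
  by near: n.
have lk : ln 2 / k <= ln (n%:R : R) by near: n.
have -> : k%:E = lebesgue_measure `[r * p + k, r * p + 2 * k]%classic.
  rewrite lebesgue_measure_itv/= lte_fin.
  have -> : r * p + k < r * p + 2 * k by lra.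
  by rewrite -EFinB; congr (_%:E); ring.
apply: le_lebesgue_measure => t /=; rewrite in_itv/= => /andP[t1 t2]; split.
  apply: (@le_trans _ _ k); last by lra.
  by rewrite ler_pdivrMr// mulrC -ler_pdivrMr.
have : r * p - k <= hn n t / ln n%:R by rewrite ler_pdivlMr// hr.
have rpt : r * p <= t by lra.
have /andP[] := min_half_lip rpt.
by move: t2; rewrite /k; set y := hn n t / _; lra.
Unshelve. all: by end_near. Qed.

(** The set is even empty for n large: h_n(t) / ln n - t + min(t, 1) / 2 is
    negative for t <= r p - kappa, and elsewhere it is bounded by
    r p + kappa - t + min(t, 1) / 2, which decreases in t. *)
Lemma h_score_null delta : 0 < delta -> \forall n \near \oo,
  lebesgue_measure
    [set t : R | ln 2 / ln n%:R <= t /\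
       bs + delta - 2^-1 <= hn n t / ln n%:R - t + Num.min t 1 / 2]
  = 0%E.
Proof.
move=> d0; pose k := delta / 3; have k0 : 0 < k by rewrite divr_gt0.
have rp0 : 0 < r * p by rewrite mulr_gt0.
have H := near_h_le k0; have H2 := near_h_le0 k0.
near=> n.
have n1 : (1 < n)%N by near: n; exists 2%N.
have ln0 : 0 < ln n%:R :> R by rewrite ln_gt0// ltr1n.
have hle : forall t, ln 2 / ln n%:R <= t -> hn n t <= (r * p + k) * ln n%:R.
  by near: n.
have hleft : forall t, ln 2 / ln n%:R <= t -> t <= r * p - k -> hn n t <= 0.
  by near: n.
rewrite (_ : [set t | _] = set0) ?measure0//.
apply/seteqP; split=> // t /= [tn].
apply/negP; rewrite -ltNge.
have t0 : 0 < t.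
  by apply: lt_le_trans tn; rewrite divr_gt0// ln_gt0 ?ltr1n.
have min0 : 0 < Num.min (r * p) 1 by rewrite lt_min rp0 ltr01.
have [tl|tr] := leP t (r * p - k).
  have : hn n t / ln n%:R <= 0 by rewrite pmulr_lle0 ?invr_gt0// hleft.
  have : Num.min t 1 <= t by rewrite ge_min lexx.
  by set y := hn n t / _; lra.
have : hn n t / ln n%:R <= r * p + k by rewrite ler_pdivrMr// hle.
set y := hn n t / _.
have [rpt|trp] := leP (r * p) t.
  by have /andP[] := min_half_lip rpt; rewrite /k; lra.
by have /andP[] := min_half_lip (ltW trp); move: tr; rewrite /k; lra.
Unshelve. all: by end_near. Qed.

Lemma h_uniform_limit :
  ereal_sup [set `|hn n t / ln n%:R - r * p|%:E | t in `[r * p + 1, +oo[]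
    @[n --> \oo] --> 0%E.
Proof.
have rp0 : 0 < r * p by rewrite mulr_gt0.
apply/fine_cvgP.
have bound e : 0 < e -> \forall n \near \oo,
    (0 <= ereal_sup [set `|hn n t / ln n%:R - r * p|%:E |
       t in `[(r * p + 1)%R, +oo[] <= e%:E)%E.
  move=> e0; pose k := Num.min e 1.
  have k0 : 0 < k by rewrite lt_min e0 ltr01.
  have ke : k <= e by rewrite ge_min lexx.
  have k1 : k <= 1 by rewrite ge_min lexx orbT.
  have H := near_h_le k0; have H2 := near_h_ge k0.
  have H3 : \forall n \near \oo, ln 2 <= ln (n%:R : R).
    apply: (@near_ln_nat _ (fun l => ln 2 <= l)).
    by apply: nbhs_pinfty_ge; exact: num_real.
  near=> n.
  have n1 : (1 < n)%N by near: n; exists 2%N.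
  have ln0 : 0 < ln n%:R :> R by rewrite ln_gt0// ltr1n.
  have ln2 : ln 2 <= ln (n%:R : R) by near: n.
  have hle : forall t, ln 2 / ln n%:R <= t -> hn n t <= (r * p + k) * ln n%:R.
    by near: n.
  have hr : forall t, r * p + k <= t -> (r * p - k) * ln n%:R <= hn n t.
    by near: n.
  apply/andP; split.
    apply: le_ereal_sup_tmp; exists `|hn n (r * p + 1) / ln n%:R - r * p|%:E.
      by exists (r * p + 1) => //=; rewrite in_itv/= lexx.
    by rewrite lee_fin.
  apply: ge_ereal_sup => _ [t t1 <-].
  move: t1; rewrite /= in_itv/= andbT => t1.
  have tn : ln 2 / ln n%:R <= t.
    apply: (@le_trans _ _ 1); last by lra.
    by rewrite ler_pdivrMr// mul1r.
  rewrite lee_fin ler_norml; apply/andP; split.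
    have : r * p - k <= hn n t / ln n%:R by rewrite ler_pdivlMr// hr//; lra.
    by lra.
  have : hn n t / ln n%:R <= r * p + k by rewrite ler_pdivrMr// hle.
  by lra.
split.
  have := bound 1 ltr01; apply: filterS => n /andP[].
  by case: (ereal_sup _).
apply/cvgr0Pnorm_le => e e0; have := bound e e0; apply: filterS => n /andP[].
rewrite /=; case: (ereal_sup _) => [x| |]//=.
by rewrite !lee_fin => x0 xe; rewrite ger0_norm.
Unshelve. all: by end_near. Qed.

(** * The detection threshold *)

Section detection.
Context (beta : {i01 R}).
Local Notation Q n :=
  (mixture (sparsity beta n) (P 0) (P (theta n))).
Local Notation eps n := (n%:R `^ (- beta%:num) : R).
Local Notation mixdens n :=
  (fun x => (1 - eps n) + eps n * density (theta n) x).

Lemma mixdensE n : has_density (P 0) (Q n) (mixdens n).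
Proof.
exact: (mixture_has_density (sparsity beta n) (densityE (powR_ge0 _ _))).
Qed.

Lemma undetectable (phi : forall n, n.-tuple (measurableTypeR R) -> R) :
  bs < beta%:num -> (forall n, is_test (phi n)) ->
  error_sum (P 0) (Q n) (phi n) @[n --> \oo] --> 1%E.
Proof.
move=> bsb tphi; have b1 : beta%:num <= 1 by [].
set b := beta%:num in bsb b1 *.
pose k := (2 * b - 1 - r * p) / 2.
(* beta <= 1 rules out min(r p, 1) = 1, hence 1 - 2 beta + r p = - 2 k *)
have k0 : 0 < k by move: bsb; rewrite /k /Num.min; case: (ltP (r * p) 1) => ?; lra.
apply: cvge_norm_le => e e0.
have H1 := near_ln_peak k0.
have H2 : \forall n \near \oo, expR (- (k * ln (n%:R : R))) < ln (1 + e ^+ 2).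
  apply: (@near_ln_nat _ (fun l => expR (- (k * l)) < ln (1 + e ^+ 2))).
  apply: (@near_pinfty_mul _ (fun l => expR (- l) < ln (1 + e ^+ 2))) => //.
  have /cvgr_lt := @cvgr_expR R; apply.
  by rewrite ln_gt0// ltrDl exprn_gt0.
near=> n.
have n1 : (1 < n)%N by near: n; exists 2%N.
have n0 : (0 < n)%N by exact: ltnW.
have /andP[_ pk] : (r * p - k) * ln n%:R <= ln (peak (theta n)) <=
  (r * p + k) * ln n%:R by near: n.
have small : expR (- (k * ln (n%:R : R))) < ln (1 + e ^+ 2) by near: n.
have th0 : 0 <= theta n by exact: powR_ge0.
have pk0 := peak_gt0 th0.
pose K := 1 + eps n ^+ 2 * peak (theta n).
have sq := integral_sqr_mixture (sparsity beta n) (densityE th0)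
  (fun x => density_le_peak x th0).
(* with s = 1 / e the bound of error_sum_near1 is (K^n - 1) / (2 e) + e / 2,
   so K^n <= 1 + e^2 suffices *)
have ei0 : 0 < e^-1 by rewrite invr_gt0.
apply: (le_trans (error_sum_near1 (mixdensE n) sq ei0 (tphi n))).
rewrite lee_fin -/K.
have Kn : K ^+ n <= 1 + e ^+ 2.
  have -> : 1 + e ^+ 2 = expR (ln (1 + e ^+ 2)).
    by rewrite lnK// posrE addr_gt0// exprn_gt0.
  apply: (@le_trans _ _ (expR (n%:R * (eps n ^+ 2 * peak (theta n))))).
    rewrite expRM_natl; apply: lerXn2r; rewrite ?nnegrE ?expR_ge0//.
      by rewrite addr_ge0// mulr_ge0 ?sqr_ge0// ltW.
    exact: expR_ge1Dx.
  rewrite ler_expR; apply/(le_trans _ (ltW small)).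
  apply: (@le_trans _ _
    (n%:R * (eps n ^+ 2 * expR ((r * p + k) * ln n%:R)))).
    rewrite ler_wpM2l// ler_wpM2l ?sqr_ge0//.
    by rewrite -[leLHS]lnK ?posrE// ler_expR.
  have nE : n%:R = expR (ln n%:R) :> R by rewrite lnK// posrE ltr0n.
  rewrite powR_natE// [X in X * _ <= _]nE expr2 -!expRD le_eqVlt; apply/orP; left.
  by apply/eqP; congr expR; rewrite /k /b; field.
rewrite (_ : (2 * e^-1)^-1 = e / 2); last by field; rewrite gt_eqF.
have : e^-1 / 2 * (K ^+ n - 1) <= e^-1 / 2 * e ^+ 2.
  rewrite ler_wpM2l//; first by rewrite divr_ge0// ltW.
  by lra.
have -> : e^-1 / 2 * e ^+ 2 = e / 2 by field; rewrite gt_eqF.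
by lra.
Unshelve. all: by end_near. Qed.

Lemma detectable : 2^-1 < beta%:num -> beta%:num < bs ->
  exists phi : forall n, n.-tuple (measurableTypeR R) -> R,
    (forall n, is_lr_test (P 0) (Q n) (phi n)) /\
    error_sum (P 0) (Q n) (phi n) @[n --> \oo] --> 0%E.
Proof.
move=> hb bbs; set b := beta%:num in hb bbs.
pose phi n := sval (cid (lr_test_error n (mixdensE n))).
have phiP n : is_lr_test (P 0) (Q n) (phi n) /\
  (error_sum (P 0) (Q n) (phi n) <=
     (\int[P 0]_x (Num.sqrt (mixdens n x))%:E) ^+ n)%E.
  by rewrite /phi; case: cid.
exists phi; split; first by move=> n; have [] := phiP n.
pose s := Num.min (r * p) 1.
have s1 : s <= 1 by rewrite ge_min lexx orbT.
have srp : s <= r * p by rewrite ge_min lexx.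
have bs' : 2 * b < s + 1 by move: bbs; rewrite -/s; lra.
(* t < s captures the signal below q (n^-t); 2 beta - 1 < t makes it visible
   among the n^(1 - t) noise points lying there *)
pose t := (2 * b - 1 + s) / 2.
have t0 : 0 < t by rewrite /t; lra.
have trp : t < r * p by rewrite /t; lra.
pose c := 1 - 2 * b + Num.min t b.
have c0 : 0 < c.
  by rewrite /c /Num.min; case: (ltP t b) => _; rewrite /t; lra.
apply: cvge_norm_le => e e0; rewrite -/b.
have H1 := near_tilt_decay t0 trp.
have H2 := near_ln_nat (near_pinfty_mul t0 near_quantile_small).
have H3 := near_ln_nat (near_linear_le_expR 192 c0).
have H4 : \forall n \near \oo, expR (- ln (n%:R : R)) < Num.min e 4^-1.
  apply: (@near_ln_nat _ (fun l => expR (- l) < Num.min e 4^-1)).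
  have /cvgr_lt := @cvgr_expR R; apply.
  by rewrite lt_min e0 invr_gt0 ltr0n.
near=> n.
have n1 : (1 < n)%N by near: n; exists 2%N.
have n0 : (0 < n)%N by exact: ltnW.
have ln0 : 0 < ln n%:R :> R by rewrite ln_gt0// ltr1n.
have [u0 ueta u1] : [/\ 0 < expR (- (t * ln n%:R)),
  expR (- (t * ln n%:R)) <= F eta & expR (- (t * ln n%:R)) < 1 / 2] by near: n.
have decay : forall u, n%:R `^ (- t) <= u < 1 ->
  ln (peak (theta n)) - theta n * gap u <= - ln n%:R by near: n.
have h3 : 192 * ln n%:R <= expR (c * ln n%:R) by near: n.
have small : expR (- ln (n%:R : R)) < Num.min e 4^-1 by near: n.
have th0 : 0 <= theta n by exact: powR_ge0.
have pk0 := peak_gt0 th0.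
rewrite -mulNr -powR_natE// in u0 ueta u1.
set u := n%:R `^ (- t) in u0 ueta u1 *.
have u01 : 0 <= u < 1 by apply/andP; split; lra.
pose A := `]-oo, q u]%classic : set (measurableTypeR R).
have mA : measurable A by exact: measurable_itv.
have PA : P 0 A = u%:E by exact: measure_quantile.
pose m := fine (P (theta n) A).
have mE : P (theta n) A = m%:E by rewrite fineK// fin_num_measure.
have m1 : m <= 1 by rewrite -lee_fin -mE probability_le1.
have m34 : 3 / 4 <= m.
  have := tail_mass th0 u01 ueta; rewrite -/A.
  have -> : P (theta n) (~` A) = (1 - m)%:E.
    by rewrite probability_setC// mE -EFinB.
  rewrite lee_fin => tail.
  have : peak (theta n) * expR (- (theta n * gap u)) <= expR (- ln n%:R).
    rewrite -[peak _]lnK ?posrE// -expRD ler_expR decay//.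
    by rewrite lexx /=; lra.
  by move: small; rewrite lt_min => /andP[_]; lra.
set ep := eps n.
have ep0 : 0 < ep by rewrite powR_gt0// ltr0n.
have ep1 : ep <= 1 by exact: powR_nat_le1.
pose qn := (1 - ep) * u + ep * m.
have QA : Q n A = qn%:E.
  by rewrite /mixture measure_addE/= /mscale/= PA mE.
have qa : ep / 4 <= qn - u.
  have -> : qn - u = ep * (m - u) by rewrite /qn; ring.
  by rewrite ler_wpM2l//; [exact: ltW|lra].
have qu : qn + u <= 2 * u + ep.
  have : ep * m <= ep by rewrite ler_piMr// ltW.
  have : 0 <= ep * u by rewrite mulr_ge0// ltW.
  by rewrite /qn; lra.
have qn0 : 0 < qn by have := ltW ep0; lra.
have err0 : (0 <= error_sum (P 0) (Q n) (phi n))%E.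
  have [[[_ phi01] _] _] := phiP n.
  rewrite /error_sum unlock adde_ge0// integral_ge0// => x _; rewrite lee_fin.
    by case/andP: (phi01 x).
  by rewrite subr_ge0; case/andP: (phi01 x).
rewrite sube0 gee0_abs//.
apply: (le_trans (phiP n).2).
apply: (le_trans (affinity_expn_le n (mixdensE n) mA PA QA qn0)).
rewrite lee_fin.
move: small; rewrite lt_min => /andP[/ltW small _].
apply: (le_trans _ small); rewrite ler_expR lerN2.
(* w dominates both u and the sparsity; 192 = 16 * 12 collects the constants *)
pose w : R := expR (- (Num.min t b * ln n%:R)).
have w0 : 0 < w by exact: expR_gt0.
have uw : u <= w.
  by rewrite /u powR_natE// ler_expR mulNr lerN2 ler_wpM2r ?ge_min ?lexx// ltW.
have epw : ep <= w.
  by rewrite /ep powR_natE// ler_expR mulNr lerN2 ler_wpM2r ?ge_min ?lexx ?orbT// ltW.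
have nE : n%:R * ep ^+ 2 = expR (c * ln n%:R) * w.
  rewrite /ep /w powR_natE// -[X in X * _ = _](@lnK R) ?posrE ?ltr0n//.
  by rewrite expr2 -!expRD; congr expR; rewrite /c -/b; ring.
have qa2 : (ep / 4) ^+ 2 <= (qn - u) ^+ 2.
  by apply: lerXn2r => //; rewrite nnegrE; have := ltW ep0; lra.
have den0 : 0 < 4 * (qn + u) by rewrite mulr_gt0// addr_gt0.
rewrite mulrA ler_pdivlMr//.
apply: (@le_trans _ _ (n%:R * (ep / 4) ^+ 2)); last by rewrite ler_wpM2l.
have -> : n%:R * (ep / 4) ^+ 2 = expR (c * ln n%:R) * w / 16 by rewrite -nE; field.
have qw : qn + u <= 3 * w by lra.
have := ler_wpM2l (ltW ln0) qw; have := ler_wpM2r (ltW w0) h3.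
by lra.
Unshelve. all: by end_near. Qed.

End detection.

End exponential_family.

Theorem theorem4p4 (R : realType)
    (P : R -> probability (measurableTypeR R) R)
    (T C L : R -> R) (eta p r : R)
    (supportP : forall v : R, 0 <= v -> P v `[0, +oo[%classic = 1%E)
    (continuousP : forall v : R, 0 <= v -> continuous (distr_fun (P v)))
    (densityP : forall v : R, 0 <= v ->
      is_density (P v) (P 0) `[0, +oo[ (fun x => C v * expR (v * T x)))
    (C_gt0 : forall v : R, 0 <= v -> 0 < C v)
    (C0 : C 0 = 1)
    (eta_gt0 : 0 < eta)
    (T_decr : forall x y : R, 0 <= x -> x < y -> y <= eta -> T y < T x)
    (T_eta : forall x : R, eta <= x -> T x <= T eta)
    (p_gt0 : 0 < p)
    (L_sv : slowly_varying L)
    (T_quantile : \forall u \near 0^'+,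
      T (quantile (P 0) 0) - T (quantile (P 0) u) = u `^ p^-1 * L u^-1)
    (r_gt0 : 0 < r) :
  let theta (n : nat) : R := n%:R `^ r in
  let mu (n : nat) := P (theta n) in
  let hn := h (P 0) (fun n x => C (theta n) * expR (theta n * T x)) in
  let bs := (Num.min (r * p) 1 + 1) / 2 in
  [/\ forall delta : R, 0 < delta ->
        (0 < limn_einf (fun n : nat => lebesgue_measure
          [set t : R | ln 2 / ln n%:R <= t /\
             bs - delta - 2^-1 <= hn n t / ln n%:R - t + Num.min t 1 / 2]%R))%E,
      forall delta : R, 0 < delta -> \forall n \near \oo,
        lebesgue_measure
          [set t : R | ln 2 / ln n%:R <= t /\
             bs + delta - 2^-1 <= hn n t / ln n%:R - t + Num.min t 1 / 2]
        = 0%E,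
      exists (M : R) (lambda : nat -> R),
        [/\ 1 <= M,
            forall n, 0 < lambda n,
            lambda n @[n --> \oo] --> (0 : R),
            forall kappa : R, 0 < kappa ->
              lambda n * n%:R `^ kappa @[n --> \oo] --> +oo &
            (exists gamma : R -> R,
               ereal_sup [set `|hn n t / ln n%:R - gamma t|%:E | t in `[M, +oo[]
                 @[n --> \oo] --> 0%E) \/
            (forall delta : R, 0 < delta -> \forall n \near \oo,
               lebesgue_measure
                 [set t : R | M <= t /\
                    bs + delta - 1 <=
                      hn n t / ln n%:R - (1 - lambda n / ln n%:R) * t]
               = 0%E)] &
      detection_threshold (P 0) mu bs].
Proof.
move=> theta mu hn bs; split.
- by move=> delta d0; apply: (@h_score_liminf R P T C L eta p).
- by move=> delta d0; apply: (@h_score_null R P T C L eta p).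
- have [lambda [lambda_gt0 lambda0 lambda_slow]] := inv_ln_rate R.
  exists (r * p + 1), lambda; split => //.
    by rewrite lerDr mulr_ge0// ltW.
  left; exists (fun=> r * p).
  by apply: (@h_uniform_limit R P T C L eta p).
- move=> beta beta_half Q; split=> [beta_big phi tphi|beta_small].
    by apply: (@undetectable R P T C L eta p).
  by apply: (@detectable R P T C L eta p).
Qed.
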